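(* Let $G$ be a finite group and $\omega$ a normalized $3$-cocycle on $G$ with values in $\Bbbk^\times$. Let $K,L\le G$ be subgroups on which the class of the restriction of $\omega$ is trivial, and let $\beta\in C^2(K,\Bbbk^\times)$, $\psi\in C^2(L,\Bbbk^\times)$ be normalized $2$-cochains with $d\beta=\omega|_{K^{\times3}}$, $d\psi=\omega|_{L^{\times3}}$. The twisted Hecke algebra $A^{K,\beta}(L,\psi)$ in $\mathcal C(G,\omega,K,\beta)$, with the structural morphisms $m,u,\Delta,\varepsilon$ given in the context, is (a) indecomposable; (b) special; and (c) separable.
   Context: $\Bbbk$ is an algebraically closed field of characteristic $0$. $\mathsf{Vec}_G^\omega$: the fusion category of finite-dimensional $G$-graded $\Bbbk$-vector spaces, with simple objects $\delta_g$ ($g\in G$; also denoting a fixed basis vector in degree $g$), associativity $\alpha_{\delta_g,\delta_{g'},\delta_{g''}}=\omega^{-1}(g,g',g'')\,\mathrm{id}:(\delta_g\otimes\delta_{g'})\otimes\delta_{g''}\to\delta_g\otimes(\delta_{g'}\otimes\delta_{g''})$, unit $\delta_e$, $l_{\delta_g}=\omega^{-1}(e,e,g)\mathrm{id}$, $r_{\delta_g}=\omega(g,e,e)\mathrm{id}$. Cocycle condition: $\omega(g_1g_2,g_3,g_4)\omega(g_1,g_2,g_3g_4)=\omega(g_1,g_2,g_3)\omega(g_1,g_2g_3,g_4)\omega(g_2,g_3,g_4)$. For a $2$-cochain $\theta$ on a subgroup $N$, $d\theta=\omega|_{N^{\times3}}$ means $\theta(f_1,f_2f_3)\theta(f_2,f_3)=\omega(f_1,f_2,f_3)\theta(f_1f_2,f_3)\theta(f_1,f_2)$.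 Scalars $\delta_{x,y}$ (two indices) are Kronecker deltas. Twisted group algebra: $A(N,\theta)=\bigoplus_{g\in N}\delta_g$ with multiplication $\delta_g\otimes\delta_{g'}\mapsto\theta(g,g')\delta_{gg'}$ and unit $\delta_e\mapsto\delta_e$. Bimodules: for an algebra $A$ in a fusion category $\mathcal C$, ${}_A\mathcal C_A$ is the monoidal category of $A$-bimodules $(M,\lambda_M,\rho_M)$ with $M\otimes_AN=\mathrm{coker}(\rho_M\otimes\mathrm{id}_N-(\mathrm{id}_M\otimes\lambda_N)\alpha_{M,A,N})$, canonical projection $\pi_{M,N}:M\otimes N\to M\otimes_AN$, unit object $A$, associativity induced by $\alpha$, unit constraints induced by $\lambda,\rho$. $x\otimes_Ay$ denotes $\pi_{M,N}(x\otimes y)$. The group-theoretical fusion category is $\mathcal C(G,\omega,K,\beta)={}_{A(K,\beta)}(\mathsf{Vec}_G^\omega)_{A(K,\beta)}$. Twisted Hecke algebra: with $A=A(K,\beta)$, $A^{K,\beta}(L,\psi)=(A\otimes A(L,\psi))\otimes A=\bigoplus_{g\in L;f,k\in K}(\delta_f\otimes\delta_g)\otimes\delta_k$, the free bimodule on $X=A(L,\psi)$, with $\rho=(\mathrm{id}_{A\otimes X}\otimes m_A)\alpha_{A\otimes X,A,A}$, $\lambda=((m_A\otimes\mathrm{id}_X)\alpha^{-1}_{A,A,X}\otimes\mathrm{id}_A)\alpha^{-1}_{A,A\otimes X,A}$. Its Frobenius structure in $\mathcal C(G,\omega,K,\beta)$ is $m[((\delta_f\otimes\delta_g)\otimes\delta_k)\otimes_A((\delta_{f'}\otimes\delta_{g'})\otimes\delta_{k'})]=\delta_{kf',e}\,\omega(fgk,f'g',k')\omega^{-1}(fg,k,f'g')\omega(k,f',g')\omega^{-1}(f,g,g')\beta(k,f')\psi(g,g')[(\delta_f\otimes\delta_{gg'})\otimes\delta_{k'}]$;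 $u(\delta_d)=\sum_{s\in K}\beta^{-1}(ds^{-1},s)[(\delta_{ds^{-1}}\otimes\delta_e)\otimes\delta_s]$; $\Delta[(\delta_f\otimes\delta_g)\otimes\delta_k]=|K|^{-1}|L|^{-1}\sum_{h\in L;s\in K}\omega(f,gh,h^{-1})\omega(fgh,s,s^{-1}h^{-1})\omega^{-1}(fghs,s^{-1}h^{-1},k)\omega^{-1}(s,s^{-1},h^{-1})\psi^{-1}(gh,h^{-1})\beta^{-1}(s,s^{-1})[((\delta_f\otimes\delta_{gh})\otimes\delta_s)\otimes_A((\delta_{s^{-1}}\otimes\delta_{h^{-1}})\otimes\delta_k)]$; $\varepsilon[(\delta_f\otimes\delta_g)\otimes\delta_k]=\delta_{g,e}|L|\beta(f,k)\delta_{fk}$. Properties, for an algebra $(B,m,u)$ in a monoidal category with unit object $\mathbf 1$ (here $\mathbf 1=A(K,\beta)$): indecomposable means not isomorphic to a direct sum of nontrivial algebras; separable means there is $\Delta':B\to B\otimes B$ with $m\Delta'=\mathrm{id}_B$ and $(\mathrm{id}\otimes m)\alpha_{B,B,B}(\Delta'\otimes\mathrm{id})=\Delta'm=(m\otimes\mathrm{id})\alpha^{-1}_{B,B,B}(\mathrm{id}\otimes\Delta')$. A Frobenius algebra $(B,m,u,\Delta,\varepsilon)$ is special if $m\Delta=\mathrm{id}_B$ and $\varepsilon u=\varphi\,\mathrm{id}_{\mathbf 1}$ for some nonzero $\varphi\in\Bbbk$. *)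

(* Defs.v *)
From HB Require Import structures.
From mathcomp Require Import all_boot all_order all_algebra all_fingroup.

Set Implicit Arguments.
Unset Strict Implicit.
Unset Printing Implicit Defensive.

Import GRing.Theory.
Local Open Scope ring_scope.

(* Overall convention: objects and morphisms are carried by raw data (spaces  *)
(* and linear maps), on which every construction below is total; the axioms   *)
(* are separate predicates (is_graded, is_bimod, bimod_hom, is_algebra,       *)
(* is_frobenius). Only for data satisfying these predicates do the induced    *)
(* maps deserve their name.                                                   *)

Section VectorSpaces.

Variable k : fieldType.
Implicit Types U V W : vectType k.

(* V (x) W is realised by the coordinates in the bases vbasis of V and W.     *)
Definition tvec V W : vectType k := 'M[k]_(\dim {:V}, \dim {:W}).

Definition tens V W (v : V) (w : W) : tvec V W :=
  \matrix_(i, j) (coord (vbasis {:V}) i v * coord (vbasis {:W}) j w).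

(* For bilinear b, the linear map sending tens v w to b v w (see tliftE).     *)
Definition tlift U V W (b : V -> W -> U) : 'Hom(tvec V W, U) :=
  linfun (fun X : tvec V W =>
    \sum_i \sum_j X i j *: b (vbasis {:V})`_i (vbasis {:W})`_j).

Definition tmap V V' W W' (f : 'Hom(V, V')) (g : 'Hom(W, W')) :
  'Hom(tvec V W, tvec V' W') := tlift (fun v w => tens (f v) (g w)).

(* The cokernel of f : V -> W is realised on a complement of the image of f,  *)
(* the canonical projection being the projection along this image.            *)
Section Cokernel.
Variables (V W : vectType k) (f : 'Hom(V, W)).
Let C : {vspace W} := ((limg f)^C)%VS.
Definition coker : vectType k := subvs_of C.
Definition coker_pi : 'Hom(W, coker) :=
  linfun (vsproj C \o daddv_pi C (limg f) : W -> coker).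
Definition coker_sec : 'Hom(coker, W) := linfun (vsval : coker -> W).
(* The map induced on the cokernel by h : W -> U with h o f = 0.              *)
Definition coker_lift U (h : 'Hom(W, U)) : 'Hom(coker, U) :=
  (h \o coker_sec)%VF.
End Cokernel.

Definition fstm V W : 'Hom((V * W)%type, V) := linfun fst.
Definition sndm V W : 'Hom((V * W)%type, W) := linfun snd.
Definition pairm U V W (f : 'Hom(U, V)) (g : 'Hom(U, W)) :
  'Hom(U, (V * W)%type) := linfun (fun u : U => (f u, g u)).

Lemma tlift_sum U V W (b : V -> W -> U) (X : tvec V W) :
  tlift b X = \sum_i \sum_j X i j *: b (vbasis {:V})`_i (vbasis {:W})`_j.
Proof.
pose F (Y : tvec V W) :=
  \sum_i \sum_j Y i j *: b (vbasis {:V})`_i (vbasis {:W})`_j.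
have linF : linear F.
  move=> c Y Z; rewrite /F scaler_sumr -big_split; apply: eq_bigr => i _ /=.
  rewrite scaler_sumr -big_split; apply: eq_bigr => j _ /=.
  by rewrite !mxE scalerDl scalerA.
pose a : GRing.isLinear k _ U *:%R F := GRing.isLinear.Build _ _ _ _ _ linF.
pose g : {linear tvec V W -> U} := HB.pack F a.
by have -> : tlift b = linfun g by []; rewrite lfunE.
Qed.

Lemma tliftE U V W (b : V -> W -> U) :
    (forall w, linear (b^~ w)) -> (forall v, linear (b v)) ->
  forall v w, tlift b (tens v w) = b v w.
Proof.
move=> bl br v w.
have Hl w0 (I : finType) (F : I -> k) (x : I -> V) :
    b (\sum_i F i *: x i) w0 = \sum_i F i *: b (x i) w0.
  pose a : GRing.isLinear k V U *:%R (b^~ w0) := GRing.isLinear.Build _ _ _ _ _ (bl w0).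
  pose g : {linear V -> U} := HB.pack (b^~ w0) a.
  by rewrite -[LHS]/(g _) linear_sum; apply: eq_bigr => i _; rewrite linearZ.
have Hr v0 (I : finType) (F : I -> k) (x : I -> W) :
    b v0 (\sum_i F i *: x i) = \sum_i F i *: b v0 (x i).
  pose a : GRing.isLinear k W U *:%R (b v0) := GRing.isLinear.Build _ _ _ _ _ (br v0).
  pose g : {linear W -> U} := HB.pack (b v0) a.
  by rewrite -[LHS]/(g _) linear_sum; apply: eq_bigr => i _; rewrite linearZ.
rewrite tlift_sum [in RHS](coord_vbasis (memvf v)) Hl.
apply: eq_bigr => i _; rewrite [in RHS](coord_vbasis (memvf w)) Hr scaler_sumr.
by apply: eq_bigr => j _; rewrite mxE scalerA.
Qed.

Lemma coker_secK V W (f : 'Hom(V, W)) x : coker_pi f (coker_sec f x) = x.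
Proof.
rewrite lfunE /= lfunE /= daddv_pi_id ?vsvalK ?subvsP //.
by rewrite capvC capv_compl.
Qed.

Lemma lker_coker_pi V W (f : 'Hom(V, W)) : lker (coker_pi f) = limg f.
Proof.
set U := limg f; set C := (U^C)%VS.
have CU0 : (C :&: U = 0)%VS by rewrite capvC capv_compl.
have UC0 : (U :&: C = 0)%VS by rewrite capv_compl.
apply/vspaceP => w; rewrite memv_ker lfunE /=.
have wCU : w \in (C + U)%VS by rewrite addvC addv_complf memvf.
have Dw := daddv_pi_add CU0 wCU.
have pC : daddv_pi C U w \in C by apply: memv_pi.
have pU : daddv_pi U C w \in U by apply: memv_pi.
apply/eqP/idP => [w0 | wU].
  by rewrite -Dw -[daddv_pi C U w](vsprojK pC) [vsproj _ _]w0 linear0 add0r.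
have D0 : daddv_pi C U w = 0.
  by apply: (addIr (daddv_pi U C w)); rewrite Dw add0r daddv_pi_id.
by rewrite /= D0 linear0.
Qed.

End VectorSpaces.

Section GradedSpaces.

Variables (k : fieldType) (gT : finGroupType).

(* The decomposition V = (+)_g V_g is recorded by the projections onto V_g.   *)
Record gvec := GVec { gcar :> vectType k; gpr : gT -> 'End(gcar) }.

Definition is_graded (V : gvec) :=
  (forall g h, (gpr V g \o gpr V h)%VF = if g == h then gpr V g else 0) /\
  \sum_g gpr V g = \1%VF.

Definition graded_hom (V W : gvec) (f : 'Hom(V, W)) :=
  forall g, (f \o gpr V g)%VF = (gpr W g \o f)%VF.

Definition gten (V W : gvec) : gvec :=
  @GVec (tvec V W) (fun g => \sum_h tmap (gpr V h) (gpr W (h^-1 * g)%g)).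

Definition gunit : gvec :=
  @GVec k^o (fun g => if g == 1%g then \1%VF else 0).

Definition gsum (V W : gvec) : gvec :=
  @GVec (V * W)%type
    (fun g => pairm (gpr V g \o fstm V W)%VF (gpr W g \o sndm V W)%VF).

(* Meant for a graded f, whose image is stable under the projections.         *)
Definition gcoker (V W : gvec) (f : 'Hom(V, W)) : gvec :=
  @GVec (coker f) (fun g => coker_lift f (coker_pi f \o gpr W g)%VF).

Variable w : gT -> gT -> gT -> k.

Definition vassoc (V W U : gvec) :
    'Hom(gten (gten V W) U, gten V (gten W U)) :=
  tlift (fun x u => tlift (fun v y =>
    \sum_g \sum_h \sum_l (w g h l)^-1 *:
      tens (gpr V g v) (tens (gpr W h y) (gpr U l u) : gten W U)) x).

Definition vassocV (V W U : gvec) :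
    'Hom(gten V (gten W U), gten (gten V W) U) :=
  tlift (fun v x => tlift (fun y u =>
    \sum_g \sum_h \sum_l w g h l *:
      tens (tens (gpr V g v) (gpr W h y) : gten V W) (gpr U l u)) x).

Definition vlunit (V : gvec) : 'Hom(gten gunit V, V) :=
  tlift (fun (c : k^o) v =>
    \sum_g (w 1%g 1%g g)^-1 *: ((c : k) *: gpr V g v)).

Definition vrunit (V : gvec) : 'Hom(gten V gunit, V) :=
  tlift (fun v (c : k^o) =>
    \sum_g w g 1%g 1%g *: ((c : k) *: gpr V g v)).

Record valg := VAlg {
  vcar :> gvec;
  vmul : 'Hom(gten vcar vcar, vcar);
  vone : 'Hom(gunit, vcar) }.

End GradedSpaces.

Section Bimodules.

Variables (k : fieldType) (gT : finGroupType) (w : gT -> gT -> gT -> k).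
Variable A : valg k gT.

Local Notation gvec := (gvec k gT).
Local Notation "V ** W" := (gten V W) (at level 40, left associativity).
Local Notation "f *m* g" := (tmap f g) (at level 40, left associativity).
Local Notation al := (vassoc w).
Local Notation alV := (vassocV w).

Record bimod := Bimod {
  bcar :> gvec;
  actl : 'Hom(A ** bcar, bcar);
  actr : 'Hom(bcar ** A, bcar) }.

Definition is_bimod (M : bimod) :=
  [/\ [/\ is_graded M, graded_hom (actl M) & graded_hom (actr M)],
      (actl M \o (vmul A *m* \1) = actl M \o (\1 *m* actl M) \o al A A M)%VF
      /\ (actl M \o (vone A *m* \1) = vlunit w M)%VF,
      (actr M \o (actr M *m* \1) = actr M \o (\1 *m* vmul A) \o al M A A)%VF
      /\ (actr M \o (\1 *m* vone A) = vrunit w M)%VF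
    & (actr M \o (actl M *m* \1) = actl M \o (\1 *m* actr M) \o al A M A)%VF].

Definition bimod_hom (M N : bimod) (f : 'Hom(M, N)) :=
  [/\ graded_hom f,
      (f \o actl M = actl N \o (\1 *m* f))%VF
    & (f \o actr M = actr N \o (f *m* \1))%VF].

Definition bdiff (M N : bimod) : 'Hom((M ** A) ** N, M ** N) :=
  ((actr M *m* \1) - ((\1 *m* actl N) \o al M A N))%VF.

Definition bpi (M N : bimod) : 'Hom(M ** N, gcoker (bdiff M N)) :=
  coker_pi (bdiff M N).
Definition bsec (M N : bimod) : 'Hom(gcoker (bdiff M N), M ** N) :=
  coker_sec (bdiff M N).

(* M (x)_A N with the actions induced by those on M and on N; as with all the *)
(* maps out of M (x)_A N below, the induced map is computed on the            *)
(* representatives selected by the section bsec of the projection bpi.        *)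
Definition bten (M N : bimod) : bimod :=
  @Bimod (gcoker (bdiff M N))
    (bpi M N \o (actl M *m* \1) \o alV A M N \o (\1 *m* bsec M N))%VF
    (bpi M N \o (\1 *m* actr N) \o al M N A \o (bsec M N *m* \1))%VF.

Definition btens (M N : bimod) (x : M) (y : N) : bten M N :=
  bpi M N (tens x y).

Definition bmap (M M' N N' : bimod) (f : 'Hom(M, M')) (g : 'Hom(N, N')) :
    'Hom(bten M N, bten M' N') :=
  (bpi M' N' \o (f *m* g) \o bsec M N)%VF.

Definition bunit : bimod := @Bimod A (vmul A) (vmul A).

Definition bassoc (M N P : bimod) :
    'Hom(bten (bten M N) P, bten M (bten N P)) :=
  (bpi M (bten N P) \o (\1 *m* bpi N P) \o al M N P
    \o (bsec M N *m* \1) \o bsec (bten M N) P)%VF.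

Definition bassocV (M N P : bimod) :
    'Hom(bten M (bten N P), bten (bten M N) P) :=
  (bpi (bten M N) P \o (bpi M N *m* \1) \o alV M N P
    \o (\1 *m* bsec N P) \o bsec M (bten N P))%VF.

Definition blunit (M : bimod) : 'Hom(bten bunit M, M) :=
  (actl M \o bsec bunit M)%VF.
Definition brunit (M : bimod) : 'Hom(bten M bunit, M) :=
  (actr M \o bsec M bunit)%VF.

Definition bsum (M N : bimod) : bimod :=
  @Bimod (gsum M N)
    (pairm (actl M \o (\1 *m* fstm M N)) (actl N \o (\1 *m* sndm M N)))%VF
    (pairm (actr M \o (fstm M N *m* \1)) (actr N \o (sndm M N *m* \1)))%VF.

Definition bfst (M N : bimod) : 'Hom(bsum M N, M) := fstm M N.
Definition bsnd (M N : bimod) : 'Hom(bsum M N, N) := sndm M N.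

Record alg := Alg {
  acar :> bimod;
  amul : 'Hom(bten acar acar, acar);
  aone : 'Hom(bunit, acar) }.

Definition is_algebra (B : alg) :=
  [/\ [/\ is_bimod B, bimod_hom (amul B) & bimod_hom (aone B)],
      (amul B \o bmap (amul B) \1
        = amul B \o bmap \1 (amul B) \o bassoc B B B)%VF,
      (amul B \o bmap (aone B) \1 = blunit B)%VF
    & (amul B \o bmap \1 (aone B) = brunit B)%VF].

Definition alg_hom (B C : alg) (f : 'Hom(B, C)) :=
  [/\ bimod_hom f,
      (f \o amul B = amul C \o bmap f f)%VF
    & (f \o aone B = aone C)%VF].

Definition alg_iso (B C : alg) :=
  exists (f : 'Hom(B, C)) (g : 'Hom(C, B)),
    [/\ alg_hom f, alg_hom g, (g \o f = \1)%VF & (f \o g = \1)%VF].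

Definition alg_sum (B C : alg) : alg :=
  @Alg (bsum B C)
    (pairm (amul B \o bmap (bfst B C) (bfst B C))
           (amul C \o bmap (bsnd B C) (bsnd B C)))%VF
    (pairm (aone B) (aone C)).

(* A sum of two or more nontrivial algebras is one of two of them, so binary *)
(* sums suffice in indecomposable.                                           *)
Definition nontrivial (B : alg) := \dim {:B} != 0%N.

Definition indecomposable (B : alg) :=
  is_algebra B /\
  ~ exists B1 B2 : alg,
      [/\ is_algebra B1, is_algebra B2, nontrivial B1, nontrivial B2
        & alg_iso B (alg_sum B1 B2)].

Definition separable (B : alg) :=
  is_algebra B /\
  exists D : 'Hom(B, bten B B),
    [/\ bimod_hom D,
        (amul B \o D = \1)%VF,
        (bmap \1 (amul B) \o bassoc B B B \o bmap D \1 = D \o amul B)%VF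
      & (D \o amul B = bmap (amul B) \1 \o bassocV B B B \o bmap \1 D)%VF].

Record frob := Frob {
  falg :> alg;
  comul : 'Hom(falg, bten falg falg);
  counit : 'Hom(falg, bunit) }.

Definition is_coalgebra (B : frob) :=
  [/\ bimod_hom (comul B) /\ bimod_hom (counit B),
      (bassoc B B B \o bmap (comul B) \1 \o comul B
        = bmap \1 (comul B) \o comul B)%VF,
      (blunit B \o bmap (counit B) \1 \o comul B = \1)%VF
    & (brunit B \o bmap \1 (counit B) \o comul B = \1)%VF].

Definition is_frobenius (B : frob) :=
  [/\ is_algebra B, is_coalgebra B,
      (bmap \1 (amul B) \o bassoc B B B \o bmap (comul B) \1
        = comul B \o amul B)%VF
    & (comul B \o amul B
        = bmap (amul B) \1 \o bassocV B B B \o bmap \1 (comul B))%VF].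

Definition special (B : frob) :=
  [/\ is_frobenius B,
      (amul B \o comul B = \1)%VF
    & exists2 phi : k, phi != 0 & (counit B \o aone B = phi *: \1)%VF].

Definition free_bimod (X : gvec) : bimod :=
  @Bimod ((A ** X) ** A)
    ((((vmul A *m* \1) \o alV A A X) *m* \1) \o alV A (A ** X) A)%VF
    ((\1 *m* vmul A) \o al (A ** X) A A)%VF.

End Bimodules.

Section Hecke.

Variables (k : fieldType) (gT : finGroupType).

(* A cochain on a subgroup N is a function on gT; only its values on N are    *)
(* constrained or used.                                                       *)
Definition cocycle3 (w : gT -> gT -> gT -> k) :=
  (forall a b c, w a b c != 0) /\
  forall a b c d,
    w (a * b)%g c d * w a b (c * d)%g = w a b c * w a (b * c)%g d * w b c d.

Definition normalized3 (w : gT -> gT -> gT -> k) :=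
  forall a b, [/\ w 1%g a b = 1, w a 1%g b = 1 & w a b 1%g = 1].

Definition cochain2 (N : {group gT}) (t : gT -> gT -> k) :=
  {in N &, forall a b, t a b != 0}.

Definition normalized2 (N : {group gT}) (t : gT -> gT -> k) :=
  {in N, forall a, t 1%g a = 1 /\ t a 1%g = 1}.

Definition trivializes (N : {group gT}) (t : gT -> gT -> k)
    (w : gT -> gT -> gT -> k) :=
  {in N & &, forall a b c,
    t a (b * c)%g * t b c = w a b c * t (a * b)%g c * t a b}.

Definition gr_group (N : {group gT}) : gvec k gT :=
  @GVec k gT {ffun subg_of N -> k^o}
    (fun g => linfun (fun a : {ffun subg_of N -> k^o} =>
      [ffun x : subg_of N => if sgval x == g then a x else 0])).

Definition delta (N : {group gT}) (g : subg_of N) : gr_group N :=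
  [ffun x : subg_of N => (x == g)%:R : k^o].

Definition twisted_alg (N : {group gT}) (t : gT -> gT -> k) : valg k gT :=
  @VAlg k gT (gr_group N)
    (tlift (fun a b : gr_group N =>
      \sum_(g : subg_of N) \sum_(h : subg_of N)
        ((a : {ffun subg_of N -> k^o}) g * (b : {ffun subg_of N -> k^o}) h
           : k) *: (t (sgval g) (sgval h) *: delta (g * h)%g)))
    (linfun (fun c : k^o => (c : k) *: delta (1%g : subg_of N))).

Variables (w : gT -> gT -> gT -> k).
Variables (K L : {group gT}) (beta psi : gT -> gT -> k).

Let A := twisted_alg K beta.

Definition hecke_bimod : bimod A := free_bimod w A (twisted_alg L psi).

Local Notation H := hecke_bimod.

Definition hbasis (f : subg_of K) (g : subg_of L) (l : subg_of K) : H :=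
  tens (tens (delta f) (delta g) : gten (gr_group K) (gr_group L)) (delta l).

(* The linear map on H with prescribed values on the basis hbasis.            *)
Definition hlift (U : vectType k)
    (F : subg_of K -> subg_of L -> subg_of K -> U) : 'Hom(H, U) :=
  tlift (fun y (c : {ffun subg_of K -> k^o}) =>
    tlift (fun (a : {ffun subg_of K -> k^o})
               (x : {ffun subg_of L -> k^o}) =>
      \sum_(f : subg_of K) \sum_(g : subg_of L) \sum_(l : subg_of K)
        (a f * x g * c l : k) *: F f g l) y).

Lemma hliftE (U : vectType k)
    (F : subg_of K -> subg_of L -> subg_of K -> U) f g l :
  hlift F (hbasis f g l) = F f g l.
Proof.
rewrite tliftE => [|y c u v|x c u v]; last first.
- rewrite !tlift_sum scaler_sumr -big_split; apply: eq_bigr => i _ /=.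
  rewrite scaler_sumr -big_split; apply: eq_bigr => j _ /=.
  rewrite scalerA mulrC -scalerA -scalerDr; congr (_ *: _).
  do 3!(rewrite scaler_sumr -big_split; apply: eq_bigr => ? _ /=).
  by rewrite !ffunE [c *: (_ *: _)]scalerA -scalerDl mulrDr mulrCA.
- by rewrite linearP.
rewrite tliftE => [|y c u v|x c u v].
- rewrite (bigD1 f) //= [X in _ + X]big1 ?addr0 => [|i /negPf ne]; last first.
    by apply: big1 => j _; apply: big1 => s _; rewrite !ffunE ne !mul0r scale0r.
  rewrite (bigD1 g) //= [X in _ + X]big1 ?addr0 => [|i /negPf ne]; last first.
    by apply: big1 => j _; rewrite !ffunE ne mulr0 mul0r scale0r.
  rewrite (bigD1 l) //= [X in _ + X]big1 ?addr0 => [|i /negPf ne]; last first.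
    by rewrite !ffunE ne mulr0 scale0r.
  by rewrite !ffunE !eqxx !mulr1 scale1r.
- do 3!(rewrite scaler_sumr -big_split; apply: eq_bigr => ? _ /=).
  by rewrite !ffunE [c *: (_ *: _)]scalerA -scalerDl !mulrDl !mulrA.
- do 3!(rewrite scaler_sumr -big_split; apply: eq_bigr => ? _ /=).
  by rewrite !ffunE [c *: (_ *: _)]scalerA -scalerDl mulrDr mulrDl !mulrA
             [_ * c]mulrC.
Qed.

(* hmul0 gives the product of representatives in H (x) H; for cocycle data it *)
(* vanishes on the image of bdiff, and hmul is the map induced on H (x)_A H.  *)
Definition hmul0 : 'Hom(gten H H, H) :=
  tlift (fun x y : H =>
    hlift (fun f g l => hlift (fun f' g' l' =>
      let: (F, G, C) := (sgval f, sgval g, sgval l) in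
      let: (F', G', C') := (sgval f', sgval g', sgval l') in
      ((C * F' == 1)%g%:R
        * w (F * G * C)%g (F' * G')%g C' * (w (F * G)%g C (F' * G')%g)^-1
        * w C F' G' * (w F G G')^-1 * beta C F' * psi G G')
      *: hbasis f (g * g')%g l') y) x).

Definition hmul : 'Hom(bten w H H, H) := (hmul0 \o bsec w H H)%VF.

Definition hone : 'Hom(bunit A, H) :=
  linfun (fun a : {ffun subg_of K -> k^o} =>
    \sum_(d : subg_of K) (a d : k) *:
      \sum_(s : subg_of K)
        (beta (sgval d * (sgval s)^-1)%g (sgval s))^-1 *:
          hbasis (d * s^-1)%g 1%g s).

Definition hcomul : 'Hom(H, bten w H H) :=
  hlift (fun f g l =>
    (#|K|%:R^-1 * #|L|%:R^-1) *:
    \sum_(h : subg_of L) \sum_(s : subg_of K)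
      let: (F, G, C) := (sgval f, sgval g, sgval l) in
      let: (h', s') := (sgval h, sgval s) in
      (w F (G * h')%g h'^-1%g
        * w (F * G * h')%g s' (s'^-1 * h'^-1)%g
        * (w (F * G * h' * s')%g (s'^-1 * h'^-1)%g C)^-1
        * (w s' s'^-1%g h'^-1%g)^-1
        * (psi (G * h')%g h'^-1%g)^-1 * (beta s' s'^-1%g)^-1)
      *: btens w (hbasis f (g * h)%g s) (hbasis s^-1%g h^-1%g l)).

Definition hcounit : 'Hom(H, bunit A) :=
  hlift (fun f g l =>
    ((g == 1%g)%:R * #|L|%:R * beta (sgval f) (sgval l)) *:
      (delta (f * l)%g : bunit A)).

Definition hecke : frob w A :=
  @Frob _ _ w A (@Alg _ _ w A H hmul hone) hcomul hcounit.

End Hecke.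

(* Main.v *)
From HB Require Import structures.
Require Import Defs.
From mathcomp Require Import all_boot all_order all_algebra all_fingroup.
From mathcomp Require Import ring.
Import GRing.Theory.
Local Open Scope ring_scope.

(* Every object has a spanning family of homogeneous vectors on which the
   structural maps are explicit, so every axiom becomes an identity between
   products of values of w, beta and psi, and each such identity is a product
   of a few instances of the cocycle condition and of the two coboundary
   conditions.  Maps out of M (x)_A N are evaluated on representatives, once
   they are known to be balanced.  Since the coproduct is a section of the
   product and satisfies the Frobenius relation, it also witnesses
   separability.

   A decomposition B = B1 + B2 would give the projection onto B1, a graded
   endomorphism F of B commuting with left and right multiplications.  The
   element e = (1 (x) 1) (x) 1 is idempotent, so F e = e.(F e).e has degree 1
   and lies in the line spanned by e; as e generates the B-bimodule B, F is a
   scalar, which the projection is not. *)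

Set Implicit Arguments.
Unset Strict Implicit.
Unset Printing Implicit Defensive.

(** Up to scalars, (f (x) g) (x) c behaves like a matrix unit with row f, column c^-1 and entry g in
    the group algebra of L twisted by psi: two of them multiply to 0 unless the inner labels cancel.
    In this picture e is a diagonal matrix unit whose corner e.B.e is a copy of that twisted group
    algebra. The corner may have a large centre, and only the grading cuts it down to a line,
    because distinct g in L have distinct degrees.

    The coefficient of each term of the coproduct is exactly the reciprocal of the coefficient with
    which the product multiplies that term back. All |K||L| terms therefore contribute equally to
    the composite of coproduct and product, which explains the prefactor of the coproduct; the same
    count gives phi = |K||L|.

    The technical obstacle is that M (x)_A N is realised on a complement chosen without regard to
    grading or actions, so no structural map can be evaluated on x (x)_A y before it is known to
    kill the image of [bdiff]. For the actions and associators of tensor products, each such check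
    amounts to one pentagon. *)

Lemma sum_single (V : nmodType) (I : finType) (j : I) (F : I -> V) :
  (forall i, i != j -> F i = 0) -> \sum_i F i = F j.
Proof. by move=> F0; apply: big_only1 => // i ne _; apply: F0. Qed.

(** * Linear algebra of tensor products and cokernels *)

Section Tensors.

Variable k : fieldType.
Implicit Types U V W : vectType k.

Lemma linfunE (V W : vectType k) (f : V -> W) x : linear f -> linfun f x = f x.
Proof.
move=> lf; pose a : GRing.isLinear k V W *:%R f := GRing.isLinear.Build _ _ _ _ _ lf.
pose h : {linear V -> W} := HB.pack f a.
by rewrite -[linfun f]/(linfun h) lfunE.
Qed.

Lemma tens_is_linear V W (v : V) : linear (tens v : W -> tvec V W).
Proof.
move=> c x y; apply/matrixP => i j; rewrite !mxE linearP /=.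
by rewrite mulrDr mulrCA.
Qed.

Lemma tensl_is_linear V W (w : W) : linear (fun v : V => tens v w).
Proof.
move=> c x y; apply/matrixP => i j; rewrite !mxE linearP /=.
by rewrite mulrDl mulrA.
Qed.

HB.instance Definition _ V W (v : V) :=
  GRing.isLinear.Build k W (tvec V W) *:%R (tens v) (@tens_is_linear V W v).

Definition rtens V W (w : W) (v : V) : tvec V W := tens v w.

HB.instance Definition _ V W (w : W) :=
  GRing.isLinear.Build k V (tvec V W) *:%R (@rtens V W w)
    (@tensl_is_linear V W w).

Lemma tensZl V W c (v : V) (w : W) : tens (c *: v) w = c *: tens v w.
Proof. by rewrite -[LHS]/(rtens w _) linearZ. Qed.

Lemma tensDl V W (v v' : V) (w : W) : tens (v + v') w = tens v w + tens v' w.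
Proof. by rewrite -[LHS]/(rtens w _) linearD. Qed.

Lemma tensZr V W c (v : V) (w : W) : tens v (c *: w) = c *: tens v w.
Proof. exact: linearZ. Qed.

Lemma tens0l V W (w : W) : tens (0 : V) w = 0.
Proof. by rewrite -[LHS]/(rtens w _) linear0. Qed.

Lemma tens0r V W (v : V) : tens v (0 : W) = 0.
Proof. exact: linear0. Qed.

Definition tensl V W (v : V) : 'Hom(W, tvec V W) := linfun (tens v).
Definition tensr V W (w : W) : 'Hom(V, tvec V W) := linfun (rtens w).

Lemma tenslE V W (v : V) (w : W) : tensl W v w = tens v w.
Proof. by rewrite lfunE. Qed.

Lemma tensrE V W (v : V) (w : W) : tensr V w v = tens v w.
Proof. by rewrite lfunE. Qed.

Lemma tens_suml V W I (r : seq I) (P : pred I) (F : I -> V) (w : W) :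
  tens (\sum_(i <- r | P i) F i) w = \sum_(i <- r | P i) tens (F i) w.
Proof. by rewrite -[LHS]/(rtens w _) linear_sum. Qed.

Lemma tens_sumr V W I (r : seq I) (P : pred I) (F : I -> W) (v : V) :
  tens v (\sum_(i <- r | P i) F i) = \sum_(i <- r | P i) tens v (F i).
Proof. exact: linear_sum. Qed.

Lemma tmapE V V' W W' (f : 'Hom(V, V')) (g : 'Hom(W, W')) v w :
  tmap f g (tens v w) = tens (f v) (g w).
Proof.
rewrite tliftE // => [w0|v0] c x y; rewrite linearP /=.
  by rewrite -[LHS]/(rtens (g w0) _) linearP.
by rewrite linearP.
Qed.

(** Evaluates the nested lifts out of which the associator is built. Linearity of the inner lift in
    its parameter [w] is seen by expanding it over the chosen bases. *)
Lemma tliftlE U V W (X : vectType k) (F : U -> V -> W -> X) :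
    (forall c u u' v w, F (c *: u + u') v w = c *: F u v w + F u' v w) ->
    (forall c u v v' w, F u (c *: v + v') w = c *: F u v w + F u v' w) ->
    (forall c u v w w', F u v (c *: w + w') = c *: F u v w + F u v w') ->
  forall u v w, tlift (fun (x : tvec U V) w => tlift (fun u v => F u v w) x)
    (tens (tens u v) w) = F u v w.
Proof.
move=> lU lV lW u v w; rewrite tliftE => [|w0 c x y|x0 c x y].
- by rewrite tliftE // => ? ? ? ?; rewrite ?lU ?lV ?lW.
- by rewrite linearP.
rewrite !tlift_sum scaler_sumr -big_split; apply: eq_bigr => i _ /=.
rewrite scaler_sumr -big_split; apply: eq_bigr => j _ /=.
by rewrite lW scalerDr !scalerA mulrC.
Qed.

Lemma tliftrE U V W (X : vectType k) (F : U -> V -> W -> X) :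
    (forall c u u' v w, F (c *: u + u') v w = c *: F u v w + F u' v w) ->
    (forall c u v v' w, F u (c *: v + v') w = c *: F u v w + F u v' w) ->
    (forall c u v w w', F u v (c *: w + w') = c *: F u v w + F u v w') ->
  forall u v w, tlift (fun u (x : tvec V W) => tlift (F u) x)
    (tens u (tens v w)) = F u v w.
Proof.
move=> lU lV lW u v w; rewrite tliftE => [|w0 c x y|x0 c x y].
- by rewrite tliftE // => ? ? ? ?; rewrite ?lU ?lV ?lW.
- rewrite !tlift_sum scaler_sumr -big_split; apply: eq_bigr => i _ /=.
  rewrite scaler_sumr -big_split; apply: eq_bigr => j _ /=.
  by rewrite lU scalerDr !scalerA mulrC.
- by rewrite linearP.
Qed.

Lemma lfunZ V W (f : 'Hom(V, W)) c v : f (c *: v) = c *: f v.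
Proof. exact: linearZ. Qed.

Lemma lfunB V W (f : 'Hom(V, W)) u v : f (u - v) = f u - f v.
Proof. exact: linearB. Qed.

Lemma lfun0 V W (f : 'Hom(V, W)) : f 0 = 0.
Proof. exact: linear0. Qed.

Lemma lfun_sum V W (f : 'Hom(V, W)) I (r : seq I) (P : pred I) (F : I -> V) :
  f (\sum_(i <- r | P i) F i) = \sum_(i <- r | P i) f (F i).
Proof. exact: linear_sum. Qed.

(* Spanning is phrased as extensionality of linear maps. *)
Definition spans V (I : Type) (e : I -> V) : Prop :=
  forall U (F G : 'Hom(V, U)), (forall i, F (e i) = G (e i)) -> F = G.

Lemma tens_ext V W U (F G : 'Hom(tvec V W, U)) :
  (forall v w, F (tens v w) = G (tens v w)) -> F = G.
Proof.
move=> FG; apply/lfunP => X.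
(* In these coordinates elementary matrices are the tensors of basis vectors. *)
have tE i j : delta_mx i j =
    tens ((vbasis {:V})`_i) ((vbasis {:W})`_j) :> tvec V W.
  apply/matrixP => i' j'; rewrite !mxE !coord_free ?(basis_free (vbasisP _)) //.
  by rewrite -natrM mulnb (eq_sym i') (eq_sym j').
have -> : X = \sum_i \sum_j X i j *: (delta_mx i j : tvec V W).
  exact: (@matrix_sum_delta k _ _ (X : 'M[k]_(\dim {:V}, \dim {:W}))).
do 2!(rewrite !linear_sum; apply: eq_bigr => ? _).
by rewrite !linearZ tE /= FG.
Qed.

Lemma tmap_id V W : tmap \1 \1 = \1%VF :> 'Hom(tvec V W, tvec V W).
Proof. by apply: tens_ext => v w; rewrite tmapE !id_lfunE. Qed.

(** Extensionality is applied to one factor at a time, the other one being frozen by [tensl] or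
    [tensr]. *)
Lemma spans_tens V W I J (e : I -> V) (e' : J -> W) :
  spans e -> spans e' -> spans (fun p : I * J => tens (e p.1) (e' p.2)).
Proof.
move=> sV sW U F G FG; apply: tens_ext => v w.
rewrite -tenslE -!comp_lfunE; congr (fun_of_lfun _ w); apply: sW => j.
rewrite !comp_lfunE !tenslE -!tensrE -!comp_lfunE.
congr (fun_of_lfun _ v); apply: sV => i.
by rewrite !comp_lfunE !tensrE (FG (i, j)).
Qed.

Lemma spans_coker V W (f : 'Hom(V, W)) I (e : I -> W) :
  spans e -> spans (fun i => coker_pi f (e i)).
Proof.
move=> sW U F G FG; apply/lfunP => x; rewrite -[x](coker_secK).
have: (F \o coker_pi f = G \o coker_pi f)%VF.
  by apply: sW => i; rewrite !comp_lfunE; apply: FG.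
by move/lfunP/(_ (coker_sec f x)); rewrite !comp_lfunE.
Qed.

Lemma coker_pi_comp V W (f : 'Hom(V, W)) x : coker_pi f (f x) = 0.
Proof. by apply/eqP; rewrite -memv_ker lker_coker_pi memv_img ?memvf. Qed.

(** The representative picked by the section differs from [x] by an element of the kernel of the
    projection, that is of the image of [f], and [h] kills this image. This removes every occurrence
    of the arbitrary section later on. *)
Lemma coker_liftE V W U (f : 'Hom(V, W)) (h : 'Hom(W, U)) x :
  (h \o f = 0)%VF -> h (coker_sec f (coker_pi f x)) = h x.
Proof.
move=> hf; apply/eqP; rewrite -subr_eq0 -linearB -memv_ker.
set y := _ - x.
have: y \in lker (coker_pi f) by rewrite memv_ker linearB /= coker_secK subrr.
rewrite lker_coker_pi => /memv_imgP [z _ ->].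
by rewrite memv_ker -comp_lfunE hf lfunE.
Qed.

Lemma fstmE V W (p : (V * W)%type) : fstm V W p = p.1.
Proof. by rewrite lfunE. Qed.

Lemma sndmE V W (p : (V * W)%type) : sndm V W p = p.2.
Proof. by rewrite lfunE. Qed.

Lemma pairmE U V W (f : 'Hom(U, V)) (g : 'Hom(U, W)) u :
  pairm f g u = (f u, g u).
Proof.
have lin : linear (fun u : U => (f u, g u) : (V * W)%type).
  by move=> c x y; rewrite !linearP.
pose a : GRing.isLinear k U (V * W)%type *:%R (fun u => (f u, g u)) :=
  GRing.isLinear.Build _ _ _ _ _ lin.
pose h : {linear U -> (V * W)%type} := HB.pack (fun u => (f u, g u)) a.
by rewrite -[pairm f g]/(linfun h) lfunE.
Qed.

End Tensors.

(** * Graded spaces, homogeneous vectors and the associator of the pointed category *)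

Section Graded.

Variables (k : fieldType) (gT : finGroupType).
Local Notation gvec := (gvec k gT).
Implicit Types V W U : gvec.

(** A relation and not a degree function: 0 is homogeneous of every degree, so vanishing products
    need no exception. *)
Definition homog V (g : gT) (v : V) :=
  forall h, gpr V h v = if h == g then v else 0.

Definition gspan V (I : Type) (d : I -> gT) (e : I -> V) :=
  (forall i, homog (d i) (e i)) /\ spans e.

Lemma gspan_graded V I d (e : I -> V) : gspan d e -> is_graded V.
Proof.
case=> he se; split=> [g h|].
  apply: se => i; rewrite comp_lfunE he (fun_if (gpr V g)) linear0 he.
  case: (eqVneq g h) => [<-|ne]; first by rewrite he; case: eqP.
  rewrite lfunE /=; case: eqP => // Dh; case: eqP => // Dg.
  by rewrite Dg Dh eqxx in ne.
apply: se => i; rewrite sum_lfunE id_lfunE (bigD1 (d i)) //= he eqxx.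
by rewrite big1 ?addr0 // => g /negPf ne; rewrite he ne.
Qed.

Lemma gspan_graded_hom V W I d (e : I -> V) (f : 'Hom(V, W)) :
  gspan d e -> (forall i, homog (d i) (f (e i))) -> graded_hom f.
Proof.
case=> he se hf g; apply: se => i; rewrite !comp_lfunE he hf (fun_if f).
by rewrite linear0.
Qed.

Lemma graded_hom_homog V W (f : 'Hom(V, W)) g v :
  graded_hom f -> homog g v -> homog g (f v).
Proof.
move=> hf hv h; rewrite -comp_lfunE -hf comp_lfunE hv (fun_if f).
by rewrite linear0.
Qed.

Lemma homogZ V g c (v : V) : homog g v -> homog g (c *: v).
Proof. by move=> hv h; rewrite linearZ /= hv; case: eqP; rewrite ?scaler0. Qed.

Lemma homog0 V g : homog g (0 : V).
Proof. by move=> h; rewrite linear0 if_same. Qed.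

Lemma homog_sum V g I (r : seq I) (P : pred I) (F : I -> V) :
  (forall i, P i -> homog g (F i)) -> homog g (\sum_(i <- r | P i) F i).
Proof.
move=> hF h; rewrite linear_sum /=.
rewrite (eq_bigr (fun i => if h == g then F i else 0)) => [|i /hF -> //].
by case: eqP => _ //; rewrite big1.
Qed.

Lemma homog_tens V W g h (v : V) (x : W) :
  homog g v -> homog h x -> homog (g * h)%g (tens v x : gten V W).
Proof.
move=> hv hx l; rewrite /= sum_lfunE (bigD1 g) //= tmapE hv hx eqxx.
rewrite big1 ?addr0 => [|i /negPf ne]; last by rewrite tmapE hv ne tens0l.
have ->: (g^-1 * l == h)%g = (l == g * h)%g.
  by rewrite -(inj_eq (mulgI g)) mulKVg.
by case: eqP; rewrite ?tens0r.
Qed.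

Lemma gspan_tens V W I J (d : I -> gT) (d' : J -> gT) (e : I -> V)
    (e' : J -> W) : gspan d e -> gspan d' e' ->
  gspan (fun p : I * J => (d p.1 * d' p.2)%g)
    (fun p => tens (e p.1) (e' p.2) : gten V W).
Proof.
move=> [he se] [he' se']; split=> [p|]; first exact: homog_tens.
exact: spans_tens.
Qed.

(** The grading of the cokernel is computed on representatives; it is independent of them because a
    graded [f] has an image stable under the projections. *)
Lemma graded_coker_pi V W (f : 'Hom(V, W)) :
  graded_hom f -> graded_hom (coker_pi f : 'Hom(W, gcoker f)).
Proof.
move=> hf g; have h0 : ((coker_pi f \o gpr W g) \o f = 0)%VF.
  apply/lfunP => y; have := hf g => /lfunP/(_ y); rewrite !comp_lfunE => <-.
  by rewrite zero_lfunE; apply: coker_pi_comp.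
apply/lfunP => x; have := coker_liftE x h0.
by rewrite !comp_lfunE => ->.
Qed.

Variable w : gT -> gT -> gT -> k.

(** On homogeneous vectors a single term of the triple sum survives, so the associator becomes a
    scalar. This is why all later computations run over homogeneous families. *)
Lemma vassocE V W U a b c (x : V) (y : W) (z : U) :
    homog a x -> homog b y -> homog c z ->
  vassoc w V W U (tens (tens x y : gten V W) z) =
    (w a b c)^-1 *: tens x (tens y z : gten W U).
Proof.
move=> hx hy hz; rewrite tliftlE => [|s p q|s p q|s p q].
- rewrite (bigD1 a) //= (bigD1 b) //= (bigD1 c) //= hx hy hz !eqxx.
  rewrite !big1 ?addr0 // => i /negPf ne.
  + by rewrite big1 // => j _; rewrite big1 // => l _; rewrite hx ne tens0l scaler0.
  + by rewrite big1 // => j _; rewrite hy ne tens0l tens0r scaler0.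
  + by rewrite hz ne !tens0r scaler0.
all: move=> *; do 3!(rewrite scaler_sumr -big_split; apply: eq_bigr => ? _ /=).
- by rewrite linearP tensDl tensZl; apply: linearP.
- by rewrite linearP tensDl tensZl; do 2!(rewrite linearP /=).
- by rewrite linearP /= !linearP.
Qed.

Lemma vassocVE V W U a b c (x : V) (y : W) (z : U) :
    homog a x -> homog b y -> homog c z ->
  vassocV w V W U (tens x (tens y z : gten W U)) =
    w a b c *: tens (tens x y : gten V W) z.
Proof.
move=> hx hy hz; rewrite tliftrE => [|s p q|s p q|s p q].
- rewrite (bigD1 a) //= (bigD1 b) //= (bigD1 c) //= hx hy hz !eqxx.
  rewrite !big1 ?addr0 // => i /negPf ne.
  + by rewrite big1 // => j _; rewrite big1 // => l _; rewrite hx ne !tens0l scaler0.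
  + by rewrite big1 // => j _; rewrite hy ne tens0r tens0l scaler0.
  + by rewrite hz ne !tens0r scaler0.
all: move=> *; do 3!(rewrite scaler_sumr -big_split; apply: eq_bigr => ? _ /=).
- by rewrite linearP tensDl tensZl tensDl tensZl; apply: linearP.
- by rewrite linearP /= linearP tensDl tensZl; apply: linearP.
- by rewrite linearP /= !linearP.
Qed.

Lemma vlunitE V a (c : k^o) (x : V) :
  homog a x -> vlunit w V (tens c x) = (w 1%g 1%g a)^-1 *: ((c : k) *: x).
Proof.
move=> hx; rewrite tliftE => [|y s p q|y s p q].
- rewrite (bigD1 a) //= hx eqxx big1 ?addr0 // => i /negPf ne.
  by rewrite hx ne !scaler0.
- rewrite scaler_sumr -big_split; apply: eq_bigr => i _ /=.
  by rewrite scalerDl scalerDr !scalerA mulrCA mulrA.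
- rewrite scaler_sumr -big_split; apply: eq_bigr => i _ /=.
  by rewrite linearP /= !scalerDr !scalerA; congr (_ *: _ + _); ring.
Qed.

Lemma vrunitE V a (c : k^o) (x : V) :
  homog a x -> vrunit w V (tens x c) = w a 1%g 1%g *: ((c : k) *: x).
Proof.
move=> hx; rewrite tliftE => [|y s p q|y s p q].
- rewrite (bigD1 a) //= hx eqxx big1 ?addr0 // => i /negPf ne.
  by rewrite hx ne !scaler0.
- rewrite scaler_sumr -big_split; apply: eq_bigr => i _ /=.
  by rewrite linearP /= !scalerDr !scalerA; congr (_ *: _ + _); ring.
- rewrite scaler_sumr -big_split; apply: eq_bigr => i _ /=.
  by rewrite scalerDl scalerDr !scalerA mulrCA mulrA.
Qed.

Lemma spans_unit : spans (fun _ : unit => 1 : gunit k gT).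
Proof.
move=> U F G FG; apply/lfunP => x.
have -> : x = (x : k) *: (1 : gunit k gT) by rewrite -[RHS]/(x * 1) mulr1.
by rewrite !lfunZ (FG tt).
Qed.

End Graded.

(* Simplification would unfold these carriers down to their projections. *)
Local Arguments bten : simpl never.
Local Arguments bunit : simpl never.
Local Arguments gten : simpl never.
Local Arguments gcoker : simpl never.

Section HomogeneousSpan.

Variables (k : fieldType) (gT : finGroupType).

(* hvec is the family of all homogeneous vectors of V. *)
Definition hidx (V : gvec k gT) := {p : gT * V & homog p.1 p.2}.
Definition hdeg V (i : hidx V) : gT := (projT1 i).1.
Definition hvec V (i : hidx V) : V := (projT1 i).2.

Lemma homog_hvec V (i : hidx V) : homog (hdeg i) (hvec i).
Proof. exact: projT2 i. Qed.

(** A vector is the sum of its components. Abstract bimodules carry no distinguished basis, and this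
    family takes its place. *)
Lemma gspan_hvec V : is_graded V -> gspan (@hdeg V) (@hvec V).
Proof.
case=> gV sV; split=> [i|U F G FG]; first exact: homog_hvec.
apply/lfunP => v; have := sV => /lfunP/(_ v); rewrite id_lfunE => <-.
rewrite sum_lfunE !linear_sum; apply: eq_bigr => g _ /=.
have hv : homog g (gpr V g v).
  by move=> h; rewrite -comp_lfunE gV; case: eqP => [->|_] //; rewrite zero_lfunE.
exact: (FG (existT _ (g, gpr V g v) hv)).
Qed.

End HomogeneousSpan.

(** * Structural maps of the category of bimodules, evaluated on x (x)_A y *)

Section BimoduleTensor.

Variables (k : fieldType) (gT : finGroupType) (w : gT -> gT -> gT -> k).
Hypothesis wc : cocycle3 w.
Variable A : valg k gT.
Hypothesis gA : is_graded A.

Implicit Types M N P : bimod A.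

Lemma cocycle_neq0 a b c : w a b c != 0.
Proof. by case: wc. Qed.

Section BtensLinear.
Variables M N : bimod A.

Lemma btensZl c (m : M) (n : N) : btens w (c *: m) n = c *: btens w m n.
Proof. by rewrite /btens tensZl linearZ. Qed.

Lemma btensZr c (m : M) (n : N) : btens w m (c *: n) = c *: btens w m n.
Proof. by rewrite /btens tensZr linearZ. Qed.

Lemma btens0l (n : N) : btens w (0 : M) n = 0.
Proof. by rewrite /btens tens0l linear0. Qed.

Lemma btens0r (m : M) : btens w m (0 : N) = 0.
Proof. by rewrite /btens tens0r linear0. Qed.

Lemma btens_suml I (r : seq I) (P : pred I) (F : I -> M) (n : N) :
  btens w (\sum_(i <- r | P i) F i) n = \sum_(i <- r | P i) btens w (F i) n.
Proof. by rewrite /btens tens_suml linear_sum. Qed.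

Lemma btens_sumr I (r : seq I) (P : pred I) (F : I -> N) (m : M) :
  btens w m (\sum_(i <- r | P i) F i) = \sum_(i <- r | P i) btens w m (F i).
Proof. by rewrite /btens tens_sumr linear_sum. Qed.

Lemma spans_btens I J (e : I -> M) (e' : J -> N) :
  spans e -> spans e' -> spans (fun p : I * J => btens w (e p.1) (e' p.2)).
Proof. by move=> se se'; apply: spans_coker (spans_tens se se'). Qed.

End BtensLinear.

Section Actions.
Variable M : bimod A.
Hypothesis bM : is_bimod w M.

Lemma bimod_graded : is_graded M.
Proof. by case: bM => [[]]. Qed.

Lemma homog_actl a b (x : A) (m : M) :
  homog a x -> homog b m -> homog (a * b)%g (actl M (tens x m)).
Proof.
by case: bM => [[_ gl _] _ _ _] hx hm; apply: graded_hom_homog gl (homog_tens hx hm).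
Qed.

Lemma homog_actr a b (x : A) (m : M) :
  homog a m -> homog b x -> homog (a * b)%g (actr M (tens m x)).
Proof.
by case: bM => [[_ _ gr] _ _ _] hm hx; apply: graded_hom_homog gr (homog_tens hm hx).
Qed.

Lemma actlA a b c (x y : A) (m : M) : homog a x -> homog b y -> homog c m ->
  actl M (tens (vmul A (tens x y)) m) =
    (w a b c)^-1 *: actl M (tens x (actl M (tens y m))).
Proof.
move=> hx hy hm; case: bM => [_ [+ _] _ _].
move/lfunP/(_ (tens (tens x y : gten A A) m)).
rewrite !comp_lfunE tmapE id_lfunE => ->.
by rewrite (vassocE w hx hy hm) !lfunZ tmapE id_lfunE.
Qed.

Lemma actrA a b c (x y : A) (m : M) : homog a m -> homog b x -> homog c y ->
  actr M (tens (actr M (tens m x)) y) =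
    (w a b c)^-1 *: actr M (tens m (vmul A (tens x y))).
Proof.
move=> hm hx hy; case: bM => [_ _ [+ _] _].
move/lfunP/(_ (tens (tens m x : gten M A) y)).
rewrite !comp_lfunE tmapE id_lfunE => ->.
by rewrite (vassocE w hm hx hy) !lfunZ tmapE id_lfunE.
Qed.

Lemma actlrA a b c (x y : A) (m : M) : homog a x -> homog b m -> homog c y ->
  actr M (tens (actl M (tens x m)) y) =
    (w a b c)^-1 *: actl M (tens x (actr M (tens m y))).
Proof.
move=> hx hm hy; case: bM => [_ _ _ +].
move/lfunP/(_ (tens (tens x m : gten A M) y)).
rewrite !comp_lfunE tmapE id_lfunE => ->.
by rewrite (vassocE w hx hm hy) !lfunZ tmapE id_lfunE.
Qed.

End Actions.

Lemma bdiffE M N a b c (m : M) (x : A) (n : N) :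
    homog a m -> homog b x -> homog c n ->
  bdiff w M N (tens (tens m x : gten M A) n) =
    tens (actr M (tens m x)) n - (w a b c)^-1 *: tens m (actl N (tens x n)).
Proof.
move=> hm hx hn; rewrite add_lfunE opp_lfunE comp_lfunE (vassocE w hm hx hn).
by rewrite lfunZ !tmapE !id_lfunE.
Qed.

(** The balancedness test: [bdiffE] is explicit on homogeneous vectors, so spanning families of them
    suffice. Stated with three arbitrary families, it can also be run on the explicit basis of the
    Hecke bimodule. *)
Lemma bdiff_comp0_basis M N (U : vectType k) (h : 'Hom(gten M N, U)) I L J
    (d : I -> gT) (dA : L -> gT) (d' : J -> gT)
    (e : I -> M) (eA : L -> A) (e' : J -> N) :
    gspan d e -> gspan dA eA -> gspan d' e' ->
    (forall i l j, h (tens (actr M (tens (e i) (eA l))) (e' j)) =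
      (w (d i) (dA l) (d' j))^-1 *: h (tens (e i) (actl N (tens (eA l) (e' j))))) ->
  (h \o bdiff w M N = 0)%VF.
Proof.
move=> [he se] [hA sA] [he' se'] hh.
apply: (spans_tens (spans_tens se sA) se') => -[[i l] j]; rewrite /fst /snd.
by rewrite comp_lfunE zero_lfunE (bdiffE (he i) (hA l) (he' j)) lfunB lfunZ
  hh subrr.
Qed.

Lemma bdiff_comp0_gspan M N (U : vectType k) (h : 'Hom(gten M N, U)) I J
    (d : I -> gT) (d' : J -> gT) (e : I -> M) (e' : J -> N) :
    gspan d e -> gspan d' e' ->
    (forall i b j (x : A), homog b x ->
      h (tens (actr M (tens (e i) x)) (e' j)) =
        (w (d i) b (d' j))^-1 *: h (tens (e i) (actl N (tens x (e' j))))) ->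
  (h \o bdiff w M N = 0)%VF.
Proof.
move=> ge ge' hh; apply: bdiff_comp0_basis ge (gspan_hvec gA) ge' _ => i l j.
exact: hh (homog_hvec l).
Qed.

Section Pair.
Variables M N : bimod A.
Hypotheses (bM : is_bimod w M) (bN : is_bimod w N).

Lemma graded_bdiff : graded_hom (bdiff w M N).
Proof.
have [gM gN] := (bimod_graded bM, bimod_graded bN).
apply: gspan_graded_hom (gspan_tens (gspan_tens (gspan_hvec gM)
  (gspan_hvec gA)) (gspan_hvec gN)) _ => -[[i j] l]; rewrite /fst /snd.
have [hi hj hl] := And3 (homog_hvec i) (homog_hvec j) (homog_hvec l).
rewrite (bdiffE hi hj hl) => h.
rewrite linearB linearZ /=.
have -> := homog_tens (homog_actr bM hi hj) hl h.
have -> := homog_tens hi (homog_actl bN hj hl) h.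
by rewrite mulgA; case: eqP => // _; rewrite scaler0 subr0.
Qed.

Lemma homog_btens a b (m : M) (n : N) :
  homog a m -> homog b n -> homog (a * b)%g (btens w m n).
Proof.
move=> hm hn.
exact: graded_hom_homog (graded_coker_pi graded_bdiff) (homog_tens hm hn).
Qed.

Lemma gspan_btens I J (d : I -> gT) (d' : J -> gT) (e : I -> M) (e' : J -> N) :
  gspan d e -> gspan d' e' ->
  gspan (fun p : I * J => (d p.1 * d' p.2)%g)
    (fun p => btens w (e p.1) (e' p.2)).
Proof.
move=> [he se] [he' se']; split=> [p|]; first exact: homog_btens.
exact: spans_btens.
Qed.

Lemma btens_mid a b c (m : M) (x : A) (n : N) :
    homog a m -> homog b x -> homog c n ->
  btens w (actr M (tens m x)) n = (w a b c)^-1 *: btens w m (actl N (tens x n)).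
Proof.
move=> hm hx hn; apply/eqP; rewrite -subr_eq0 -linearZ -linearB.
by rewrite -(bdiffE hm hx hn); apply/eqP; apply: coker_pi_comp.
Qed.

Lemma bdiff_comp0 (U : vectType k) (h : 'Hom(gten M N, U)) :
    (forall a b c (m : M) (x : A) (n : N),
      homog a m -> homog b x -> homog c n ->
      h (tens (actr M (tens m x)) n) =
        (w a b c)^-1 *: h (tens m (actl N (tens x n)))) ->
  (h \o bdiff w M N = 0)%VF.
Proof.
move=> hh; have [gM gN] := (bimod_graded bM, bimod_graded bN).
apply: bdiff_comp0_gspan (gspan_hvec gM) (gspan_hvec gN) _ => i b j x hx.
exact: hh (homog_hvec i) hx (homog_hvec j).
Qed.

End Pair.

Lemma bsec_btens M N (U : vectType k) (h : 'Hom(gten M N, U)) m n :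
  (h \o bdiff w M N = 0)%VF -> h (bsec w M N (btens w m n)) = h (tens m n).
Proof. exact: coker_liftE. Qed.

(** The cocycle condition as a quotient equal to 1. In this form it can be inserted as a factor into
    an identity of monomials, to any integer power, and [field] does the rest. *)
Definition wrel a b c d := (w (a * b)%g c d * w a b (c * d)%g) /
  (w a b c * w a (b * c)%g d * w b c d).

Lemma wrelE a b c d : wrel a b c d = 1.
Proof. by case: wc => w0 wE; rewrite /wrel wE divff ?mulf_neq0. Qed.

Lemma eq_mulr_one (x y c : k) : c = 1 -> x = y * c -> x = y.
Proof. by move=> ->; rewrite mulr1. Qed.

Section PairActions.
Variables M N : bimod A.
Hypotheses (bM : is_bimod w M) (bN : is_bimod w N).

(** The formula holds on [tens m n]; it descends because the resulting map is balanced, by the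
    pentagon for [x], [m], the element moved across, and [n]. *)
Lemma actl_btens a b c (x : A) (m : M) (n : N) :
    homog a x -> homog b m -> homog c n ->
  actl (bten w M N) (tens x (btens w m n)) =
    w a b c *: btens w (actl M (tens x m)) n.
Proof.
move=> hx hm hn; rewrite !comp_lfunE tmapE id_lfunE.
pose h := (bpi w M N \o tmap (actl M) \1 \o vassocV w A M N
            \o (tensl (gten M N) x : 'Hom(_, gten A (gten M N))))%VF.
have hE m' n' b' c' : homog b' m' -> homog c' n' ->
    h (tens m' n') = w a b' c' *: btens w (actl M (tens x m')) n'.
  move=> hm' hn'; rewrite !comp_lfunE tenslE (vassocVE w hx hm' hn').
  by rewrite !lfunZ tmapE id_lfunE.
have h0 : (h \o bdiff w M N = 0)%VF.
  apply: (bdiff_comp0 bM bN) => b' l c' m' y n' hm' hy hn'.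
  rewrite (hE _ _ _ _ (homog_actr bM hm' hy) hn').
  rewrite (hE _ _ _ _ hm' (homog_actl bN hy hn')).
  (* The relation is taken with [actl M (tens x m')] on the left; [actlrA] turns its left side into
     the wanted vector up to an invertible scalar, which is then moved across. *)
  have := btens_mid (homog_actl bM hx hm') hy hn'.
  rewrite (actlrA bM hx hm' hy) btensZl.
  move/(canRL (scalerK _)) => ->; last by rewrite invr_eq0 cocycle_neq0.
  rewrite !scalerA; congr (_ *: _).
  apply: (@eq_mulr_one _ _ (wrel a b' l c')^-1); first by rewrite wrelE invr1.
  by rewrite /wrel; field; rewrite !cocycle_neq0 ?oner_neq0.
by have := bsec_btens m n h0; rewrite (hE _ _ _ _ hm hn) => <-;
  rewrite !comp_lfunE tenslE.
Qed.

Lemma actr_btens a b c (x : A) (m : M) (n : N) :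
    homog a m -> homog b n -> homog c x ->
  actr (bten w M N) (tens (btens w m n) x) =
    (w a b c)^-1 *: btens w m (actr N (tens n x)).
Proof.
move=> hm hn hx; rewrite !comp_lfunE tmapE id_lfunE.
pose h := (bpi w M N \o tmap \1 (actr N) \o vassoc w M N A
            \o (tensr (gten M N) x : 'Hom(_, gten (gten M N) A)))%VF.
have hE m' n' b' c' : homog b' m' -> homog c' n' ->
    h (tens m' n') = (w b' c' c)^-1 *: btens w m' (actr N (tens n' x)).
  move=> hm' hn'; rewrite !comp_lfunE tensrE (vassocE w hm' hn' hx).
  by rewrite !lfunZ tmapE id_lfunE.
have h0 : (h \o bdiff w M N = 0)%VF.
  apply: (bdiff_comp0 bM bN) => b' l c' m' y n' hm' hy hn'.
  rewrite (hE _ _ _ _ (homog_actr bM hm' hy) hn').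
  rewrite (hE _ _ _ _ hm' (homog_actl bN hy hn')).
  rewrite (btens_mid hm' hy (homog_actr bN hn' hx)).
  rewrite (actlrA bN hy hn' hx) btensZr !scalerA; congr (_ *: _).
  apply: (@eq_mulr_one _ _ (wrel b' l c' c)^-1); first by rewrite wrelE invr1.
  by rewrite /wrel; field; rewrite !cocycle_neq0 ?oner_neq0.
by have := bsec_btens m n h0; rewrite (hE _ _ _ _ hm hn) => <-;
  rewrite !comp_lfunE tensrE.
Qed.

End PairActions.

(** Right linearity of [f] and left linearity of [g] carry the relations of the source to those of
    the target; degrees being preserved, the associator scalars agree. *)
Lemma bmapE M M' N N' (f : 'Hom(M, M')) (g : 'Hom(N, N')) m n :
    is_graded M -> is_graded N -> bimod_hom f -> bimod_hom g ->
  bmap w f g (btens w m n) = btens w (f m) (g n).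
Proof.
move=> /gspan_hvec gM /gspan_hvec gN [gf _ fr] [gg gl _].
have hr x a : f (actr M (tens x a)) = actr M' (tens (f x) a).
  by have /lfunP/(_ (tens x a)) := fr; rewrite !comp_lfunE tmapE id_lfunE.
have hl x a : g (actl N (tens a x)) = actl N' (tens a (g x)).
  by have /lfunP/(_ (tens a x)) := gl; rewrite !comp_lfunE tmapE id_lfunE.
have h0 : ((bpi w M' N' \o tmap f g) \o bdiff w M N = 0)%VF.
  apply: (bdiff_comp0_gspan gM gN) => i a j x hx.
  rewrite !comp_lfunE !tmapE hr hl.
  exact: btens_mid (graded_hom_homog gf (homog_hvec i)) hx
    (graded_hom_homog gg (homog_hvec j)).
by have := bsec_btens m n h0; rewrite !comp_lfunE tmapE.
Qed.

Lemma bimod_hom_id M : bimod_hom (\1 : 'Hom(M, M)).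
Proof.
by split=> [g||]; rewrite ?[tmap _ _]tmap_id !comp_lfun1l !comp_lfun1r.
Qed.

Section Triple.
Variables M N P : bimod A.
Hypotheses (bM : is_bimod w M) (bN : is_bimod w N) (bP : is_bimod w P).

(** Two nested sections must be removed. [F] is balanced in its first two arguments, which disposes
    of the inner one ([FsE]); the map [G] so obtained is balanced in turn, which disposes of the
    outer one. Each of the two steps is one pentagon. *)
Lemma bassocE a b c (m : M) (n : N) (p : P) :
    homog a m -> homog b n -> homog c p ->
  bassoc w M N P (btens w (btens w m n) p) =
    (w a b c)^-1 *: btens w m (btens w n p).
Proof.
move=> hm hn hp.
pose F := (bpi w M (bten w N P) \o tmap \1 (bpi w N P) \o vassoc w M N P)%VF.
have FE a' b' c' m' n' p' : homog a' m' -> homog b' n' -> homog c' p' ->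
    F (tens (tens m' n' : gten M N) p') =
      (w a' b' c')^-1 *: btens w m' (btens w n' p').
  move=> hm' hn' hp'; rewrite !comp_lfunE (vassocE w hm' hn' hp').
  by rewrite !lfunZ tmapE id_lfunE.
have FsE m' n' c' p' : homog c' p' ->
    F (tens (bsec w M N (btens w m' n')) p') = F (tens (tens m' n' : gten M N) p').
  move=> hp'; pose h := (F \o (tensr (gten M N) p' : 'Hom(_, gten (gten M N) P)))%VF.
  have hE x : h x = F (tens x p') by rewrite comp_lfunE tensrE.
  rewrite -!hE; apply: bsec_btens; apply: (bdiff_comp0 bM bN).
  move=> a' b' d' x y z hx hy hz; rewrite !hE.
  rewrite (FE _ _ _ _ _ _ (homog_actr bM hx hy) hz hp').
  rewrite (FE _ _ _ _ _ _ hx (homog_actl bN hy hz) hp').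
  rewrite (btens_mid hx hy (homog_btens bN bP hz hp')).
  rewrite (actl_btens bN bP hy hz hp') btensZr !scalerA; congr (_ *: _).
  apply: (@eq_mulr_one _ _ (wrel a' b' d' c')^-1); first by rewrite wrelE invr1.
  by rewrite /wrel; field; rewrite !cocycle_neq0 ?oner_neq0.
pose G := (F \o (tmap (bsec w M N) \1 : 'Hom(gten (bten w M N) P, _)))%VF.
have GE a' b' c' m' n' p' : homog a' m' -> homog b' n' -> homog c' p' ->
    G (tens (btens w m' n' : bten w M N) p') =
      (w a' b' c')^-1 *: btens w m' (btens w n' p').
  move=> hm' hn' hp'; rewrite comp_lfunE tmapE id_lfunE (FsE _ _ _ _ hp').
  exact: FE.
have := bsec_btens (btens w m n) p (_ : G \o bdiff w (bten w M N) P = 0)%VF.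
rewrite (GE _ _ _ _ _ _ hm hn hp) => <-.
  by rewrite !comp_lfunE.
have [gM gN gP] := And3 (gspan_hvec (bimod_graded bM))
  (gspan_hvec (bimod_graded bN)) (gspan_hvec (bimod_graded bP)).
apply: (bdiff_comp0_gspan (gspan_btens bM bN gM gN) gP).
move=> [i j] b' l x hx; rewrite /fst /snd.
have [hi hj hl] := And3 (homog_hvec i) (homog_hvec j) (homog_hvec l).
rewrite (actr_btens bM bN hi hj hx) tensZl lfunZ.
rewrite (GE _ _ _ _ _ _ hi (homog_actr bN hj hx) hl).
rewrite (GE _ _ _ _ _ _ hi hj (homog_actl bP hx hl)).
rewrite (btens_mid hj hx hl) btensZr !scalerA; congr (_ *: _).
apply: (eq_mulr_one (wrelE (hdeg i) (hdeg j) b' (hdeg l))).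
by rewrite /wrel; field; rewrite !cocycle_neq0 ?oner_neq0.
Qed.

Lemma bassocVE a b c (m : M) (n : N) (p : P) :
    homog a m -> homog b n -> homog c p ->
  bassocV w M N P (btens w m (btens w n p)) =
    w a b c *: btens w (btens w m n) p.
Proof.
move=> hm hn hp.
pose F := (bpi w (bten w M N) P \o tmap (bpi w M N) \1 \o vassocV w M N P)%VF.
have FE a' b' c' m' n' p' : homog a' m' -> homog b' n' -> homog c' p' ->
    F (tens m' (tens n' p' : gten N P)) =
      w a' b' c' *: btens w (btens w m' n') p'.
  move=> hm' hn' hp'; rewrite !comp_lfunE (vassocVE w hm' hn' hp').
  by rewrite !lfunZ tmapE id_lfunE.
have FsE a' m' n' p' : homog a' m' ->
    F (tens m' (bsec w N P (btens w n' p'))) = F (tens m' (tens n' p' : gten N P)).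
  move=> hm'; pose h := (F \o (tensl (gten N P) m' : 'Hom(_, gten M (gten N P))))%VF.
  have hE x : h x = F (tens m' x) by rewrite comp_lfunE tenslE.
  rewrite -!hE; apply: bsec_btens; apply: (bdiff_comp0 bN bP).
  move=> b' c' d' x y z hx hy hz; rewrite !hE.
  rewrite (FE _ _ _ _ _ _ hm' (homog_actr bN hx hy) hz).
  rewrite (FE _ _ _ _ _ _ hm' hx (homog_actl bP hy hz)).
  have := btens_mid (homog_btens bM bN hm' hx) hy hz.
  rewrite (actr_btens bM bN hm' hx hy) btensZl.
  move/(canRL (scalerK _)) => ->; last by rewrite invr_eq0 cocycle_neq0.
  rewrite !scalerA; congr (_ *: _).
  apply: (@eq_mulr_one _ _ (wrel a' b' c' d')^-1); first by rewrite wrelE invr1.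
  by rewrite /wrel; field; rewrite !cocycle_neq0 ?oner_neq0.
pose G := (F \o (tmap \1 (bsec w N P) : 'Hom(gten M (bten w N P), _)))%VF.
have GE a' b' c' m' n' p' : homog a' m' -> homog b' n' -> homog c' p' ->
    G (tens m' (btens w n' p' : bten w N P)) =
      w a' b' c' *: btens w (btens w m' n') p'.
  move=> hm' hn' hp'; rewrite comp_lfunE tmapE id_lfunE (FsE _ _ _ _ hm').
  exact: FE.
have := bsec_btens m (btens w n p) (_ : G \o bdiff w M (bten w N P) = 0)%VF.
rewrite (GE _ _ _ _ _ _ hm hn hp) => <-.
  by rewrite !comp_lfunE.
have [gM gN gP] := And3 (gspan_hvec (bimod_graded bM))
  (gspan_hvec (bimod_graded bN)) (gspan_hvec (bimod_graded bP)).
apply: (bdiff_comp0_gspan gM (gspan_btens bN bP gN gP)).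
move=> i b' [j l] x hx; rewrite /fst /snd.
have [hi hj hl] := And3 (homog_hvec i) (homog_hvec j) (homog_hvec l).
rewrite (actl_btens bN bP hx hj hl) tensZr lfunZ.
rewrite (GE _ _ _ _ _ _ (homog_actr bM hi hx) hj hl).
rewrite (GE _ _ _ _ _ _ hi (homog_actl bN hx hj) hl).
rewrite (btens_mid hi hx hj) btensZl !scalerA; congr (_ *: _).
apply: (@eq_mulr_one _ _ (wrel (hdeg i) b' (hdeg j) (hdeg l))); first exact: wrelE.
by rewrite /wrel; field; rewrite !cocycle_neq0 ?oner_neq0.
Qed.

End Triple.

(** Balancedness of the left action is its associativity. *)
Lemma blunitE M (x : A) (m : M) : is_bimod w M ->
  blunit w M (btens w (x : bunit A) m) = actl M (tens x m).
Proof.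
move=> bM; have hM := gspan_hvec (bimod_graded bM).
have h0 : ((actl M : 'Hom(gten (bunit A) M, _)) \o bdiff w (bunit A) M = 0)%VF.
  apply: (@bdiff_comp0_gspan (bunit A) M _ _ _ _ _ _ _ _ (gspan_hvec gA) hM).
  move=> i b j y hy /=; exact: (actlA bM (homog_hvec i) hy (homog_hvec j)).
by have := bsec_btens (x : bunit A) m h0; rewrite comp_lfunE.
Qed.

Lemma brunitE M (x : A) (m : M) : is_bimod w M ->
  brunit w M (btens w m (x : bunit A)) = actr M (tens m x).
Proof.
move=> bM; have hM := gspan_hvec (bimod_graded bM).
have h0 : ((actr M : 'Hom(gten M (bunit A), _)) \o bdiff w M (bunit A) = 0)%VF.
  apply: (@bdiff_comp0_gspan M (bunit A) _ _ _ _ _ _ _ _ hM (gspan_hvec gA)).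
  move=> i b j y hy /=; exact: (actrA bM (homog_hvec i) hy (homog_hvec j)).
by have := bsec_btens m (x : bunit A) h0; rewrite comp_lfunE.
Qed.

End BimoduleTensor.

(** * Scalar identities between the cochains, one for each axiom *)

Section HeckeCoefficients.

Variables (k : fieldType) (gT KT LT : finGroupType).
Variables (w : gT -> gT -> gT -> k) (u : KT -> gT) (v : LT -> gT).
Variables (b : KT -> KT -> k) (p : LT -> LT -> k).

(* u and v stand for the inclusions of K and L into gT; working with the
   subgroups as types makes b = beta and p = psi total cochains. *)
Record hecke_cochains : Prop := HeckeCochains {
  w_cocycle : cocycle3 w;
  w_normalized : normalized3 w;
  u_morph : {morph u : x y / (x * y)%g};
  v_morph : {morph v : x y / (x * y)%g};
  v_inj : injective v;
  b_neq0 : forall x y, b x y != 0;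
  p_neq0 : forall x y, p x y != 0;
  b_normalized : forall x, b 1%g x = 1 /\ b x 1%g = 1;
  p_normalized : forall x, p 1%g x = 1 /\ p x 1%g = 1;
  b_trivializes : forall x y z,
    b x (y * z)%g * b y z = w (u x) (u y) (u z) * b (x * y)%g z * b x y;
  p_trivializes : forall x y z,
    p x (y * z)%g * p y z = w (v x) (v y) (v z) * p (x * y)%g z * p x y }.

Hypothesis hc : hecke_cochains.

(** The coboundary condition as a quotient equal to 1, for the same use as [wrel]. *)
Definition brel x y z :=
  (b x (y * z)%g * b y z) / (w (u x) (u y) (u z) * b (x * y)%g z * b x y).
Definition prel x y z :=
  (p x (y * z)%g * p y z) / (w (v x) (v y) (v z) * p (x * y)%g z * p x y).

Let w0 a c d : w a c d != 0. Proof. exact/cocycle_neq0/(w_cocycle hc). Qed.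

Lemma brelE x y z : brel x y z = 1.
Proof. by rewrite /brel (b_trivializes hc) divff ?mulf_neq0 ?(b_neq0 hc). Qed.

Lemma prelE x y z : prel x y z = 1.
Proof. by rewrite /prel (p_trivializes hc) divff ?mulf_neq0 ?(p_neq0 hc). Qed.

Let w1 a c : w 1%g a c = 1. Proof. by case: (w_normalized hc a c). Qed.
Let w2 a c : w a 1%g c = 1. Proof. by case: (w_normalized hc a c). Qed.
Let w3 a c : w a c 1%g = 1. Proof. by case: (w_normalized hc a c). Qed.

Let b1l x : b 1%g x = 1. Proof. by case: (b_normalized hc x). Qed.
Let b1r x : b x 1%g = 1. Proof. by case: (b_normalized hc x). Qed.
Let p1l x : p 1%g x = 1. Proof. by case: (p_normalized hc x). Qed.
Let p1r x : p x 1%g = 1. Proof. by case: (p_normalized hc x). Qed.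

Lemma morph_u1 : u 1%g = 1%g.
Proof. by apply: (mulgI (u 1)%g); rewrite -(u_morph hc) !mulg1. Qed.
Lemma morph_v1 : v 1%g = 1%g.
Proof. by apply: (mulgI (v 1)%g); rewrite -(v_morph hc) !mulg1. Qed.
Lemma morph_uV x : u x^-1%g = (u x)^-1%g.
Proof. by apply: (mulgI (u x)); rewrite -(u_morph hc) !mulgV morph_u1. Qed.
Lemma morph_vV x : v x^-1%g = (v x)^-1%g.
Proof. by apply: (mulgI (v x)); rewrite -(v_morph hc) !mulgV morph_v1. Qed.

(** The left action of the free bimodule passes through two inverse associators, hence two values of
    [w]; the right action passes through one associator, hence the inverse in [actr_coef]. *)
Definition actl_coef a f g c :=
  w (u a) (u f * v g)%g (u c) * w (u a) (u f) (v g) * b a f.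
Definition actr_coef f g c a := (w (u f * v g)%g (u c) (u a))^-1 * b c a.
Definition mul_coef f g c f' g' c' :=
  w (u f * v g * u c)%g (u f' * v g')%g (u c')
  * (w (u f * v g)%g (u c) (u f' * v g')%g)^-1
  * w (u c) (u f') (v g') * (w (u f) (v g) (v g'))^-1 * b c f' * p g g'.
Definition comul_coef f g c h s :=
  w (u f) (v g * v h)%g (v h)^-1%g
  * w (u f * v g * v h)%g (u s) ((u s)^-1 * (v h)^-1)%g
  * (w (u f * v g * v h * u s)%g ((u s)^-1 * (v h)^-1)%g (u c))^-1
  * (w (u s) (u s)^-1%g (v h)^-1%g)^-1
  * (p (g * h)%g h^-1%g)^-1 * (b s s^-1%g)^-1.
Definition triple_deg f g c := (u f * v g * u c)%g.

Local Notation deg := triple_deg.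

(* The argument is a product of relators wrel, brel, prel and their inverses,
   each equal to 1, whose multiplication transforms one side of the identity
   into the other after reducing the group words.  The products below were
   found by solving the corresponding linear system over the integers. *)
Ltac certificate rel :=
  apply: (@eq_mulr_one _ _ _ rel);
    first (by rewrite ?(wrelE (w_cocycle hc)) ?brelE ?prelE ?invr1 ?mulr1 ?invr1);
  rewrite /actl_coef /actr_coef /mul_coef /comul_coef /triple_deg /wrel /brel /prel;
  rewrite ?(u_morph hc, v_morph hc, morph_uV, morph_vV, morph_u1, morph_v1, invMg, invgK,
    invg1, mulg1, mul1g, mulVg, mulgV, mulgA, mulgK, mulgVK,
    w1, w2, w3, b1l, b1r, p1l, p1r);
  try reflexivity;
  by field; rewrite ?w0 ?(b_neq0 hc) ?(p_neq0 hc) ?oner_neq0.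

Local Notation W := (wrel w).

Lemma deg_actl x f g c : deg (x * f)%g g c = (u x * deg f g c)%g.
Proof. by rewrite /triple_deg (u_morph hc) !mulgA. Qed.

Lemma deg_actr x f g c : deg f g (c * x)%g = (deg f g c * u x)%g.
Proof. by rewrite /triple_deg (u_morph hc) !mulgA. Qed.

Lemma deg_mul f g c h d :
  deg f (g * h)%g d = (deg f g c * deg c^-1%g h d)%g.
Proof. by rewrite /triple_deg morph_uV (v_morph hc) !mulgA mulgK. Qed.

Lemma deg_comul f g c h s :
  deg f g c = (deg f (g * h)%g s * deg s^-1%g h^-1%g c)%g.
Proof. by rewrite -deg_mul mulgK. Qed.

Lemma actl_coef1 f g c : actl_coef 1%g f g c = 1.
Proof. certificate (1 : k). Qed.

Lemma actr_coef1 f g c : actr_coef f g c 1%g = 1.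
Proof. certificate (1 : k). Qed.

Lemma mul_coef11 f g c : mul_coef f g 1%g 1%g 1%g c = 1.
Proof. certificate (1 : k). Qed.

Lemma actl_coefA x y f g c :
  b x y * actl_coef (x * y)%g f g c =
  (w (u x) (u y) (deg f g c))^-1 * (actl_coef y f g c * actl_coef x (y * f)%g g c).
Proof.
certificate ((brel x y f)^-1 * W (u x) (u y) (u f * v g)%g (u c)
  * W (u x) (u y) (u f) (v g)).
Qed.

Lemma actr_coefA f g c x y :
  actr_coef f g c x * actr_coef f g (c * x)%g y =
  (w (deg f g c) (u x) (u y))^-1 * (b x y * actr_coef f g c (x * y)%g).
Proof.
certificate ((brel c x y)^-1 * W (u f * v g)%g (u c) (u x) (u y)).
Qed.

Lemma actlr_coef x f g c y :
  actl_coef x f g c * actr_coef (x * f)%g g c y =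
  (w (u x) (deg f g c) (u y))^-1
    * (actr_coef f g c y * actl_coef x f g (c * y)%g).
Proof. certificate (W (u x) (u f * v g)%g (u c) (u y))^-1. Qed.

(** Balancedness of the product over A. Moving x across leaves the support condition unchanged: f' =
    (c x)^-1 on one side, x f' = c^-1 on the other, and only this case needs a scalar identity. *)
Lemma mul_coef_mid f g c x h d :
  actr_coef f g c x * mul_coef f g (c * x)%g (c * x)^-1%g h d =
  (w (deg f g c) (u x) (deg (c * x)^-1%g h d))^-1
    * (actl_coef x (c * x)^-1%g h d * mul_coef f g c c^-1%g h d).
Proof.
certificate (W (deg f g c) (u x) (u (c * x)^-1%g * v h)%g (u d)
  * (brel (c * x)%g x^-1%g x)^-1 * W (u f * v g)%g (u c) (u x) (u (c * x)^-1%g * v h)%g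
  * (brel x^-1%g x (c * x)^-1%g)^-1 * W (u (c * x)%g) (u x)^-1%g (u x) (u (c * x)^-1%g)
  * W (u c) (u x) (u (c * x)^-1%g) (v h) * brel (c * x)%g x^-1%g c^-1%g).
Qed.

Lemma mul_coef_actl x f g c h d :
  w (u x) (deg f g c) (deg c^-1%g h d) * actl_coef x f g c
    * mul_coef (x * f)%g g c c^-1%g h d =
  mul_coef f g c c^-1%g h d * actl_coef x f (g * h)%g d.
Proof.
certificate ((W (u x) (u f * v g)%g (u c) (u c^-1%g * v h)%g)^-1
  * W (u x) (deg f g c) (u c^-1%g * v h)%g (u d)
  * (W (u x) (u f) (v g) (v h))^-1).
Qed.

Lemma mul_coef_actr f g c h d x :
  (w (deg f g c) (deg c^-1%g h d) (u x))^-1 * actr_coef c^-1%g h d x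
    * mul_coef f g c c^-1%g h (d * x)%g =
  mul_coef f g c c^-1%g h d * actr_coef f (g * h)%g d x.
Proof. certificate (W (deg f g c) (u c^-1%g * v h)%g (u d) (u x)). Qed.

Lemma mul_coefA f g c h d i e :
  mul_coef f g c c^-1%g h d * mul_coef f (g * h)%g d d^-1%g i e =
  (w (deg f g c) (deg c^-1%g h d) (deg d^-1%g i e))^-1
    * (mul_coef c^-1%g h d d^-1%g i e * mul_coef f g c c^-1%g (h * i)%g e).
Proof.
certificate ((W (u c) (u c^-1%g) (v h) (v i))^-1
  * (W (deg f g c) (u c^-1%g * v h)%g (u d) (u d^-1%g * v i)%g)^-1
  * W (deg f g c) (deg c^-1%g h d) (u d^-1%g * v i)%g (u e) * (prel g h i)^-1
  * W (u f) (v g) (v h) (v i) * W (u f * v g)%g (u c) (u c^-1%g * v h)%g (v i)).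
Qed.

(** Left unit law: this is the one summand s = f^-1 of the unit at x that composes with the label
    f. *)
Lemma mul_coef1l x f g c :
  (b (x * f)%g f^-1%g)^-1 * mul_coef (x * f)%g 1%g f^-1%g f g c = actl_coef x f g c.
Proof.
certificate (brel (x * f)%g f^-1%g f * (W (u (x * f)%g) (u f^-1%g) (u f) (v g))^-1).
Qed.

Lemma mul_coef1r f g c x :
  (b c^-1%g (c * x)%g)^-1 * mul_coef f g c c^-1%g 1%g (c * x)%g = actr_coef f g c x.
Proof.
certificate ((brel c c^-1%g (c * x)%g)^-1
  * W (u f * v g)%g (u c) (u c^-1%g) (u (c * x)%g)).
Qed.

Lemma one_coef_actl x d s :
  b x d * (b (x * d * s^-1)%g s)^-1 =
  (b (d * s^-1)%g s)^-1 * actl_coef x (d * s^-1)%g 1%g s.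
Proof. certificate (brel x (d * s^-1)%g s). Qed.

Lemma one_coef_actr d s x :
  b d x * (b (d * s^-1)%g (s * x)%g)^-1 =
  (b (d * s^-1)%g s)^-1 * actr_coef (d * s^-1)%g 1%g s x.
Proof. certificate (brel (d * s^-1)%g s x)^-1. Qed.

Lemma counit_coef_actl x f c :
  actl_coef x f 1%g c * b (x * f)%g c = b f c * b x (f * c)%g.
Proof. certificate (brel x f c)^-1. Qed.

Lemma counit_coef_actr f c x :
  actr_coef f 1%g c x * b f (c * x)%g = b f c * b (f * c)%g x.
Proof. certificate (brel f c x). Qed.

Lemma comul_coef_actl x f g c h s :
  actl_coef x f g c * comul_coef (x * f)%g g c h s =
  comul_coef f g c h s * w (u x) (deg f (g * h)%g s) (deg s^-1%g h^-1%g c)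
    * actl_coef x f (g * h)%g s.
Proof.
certificate ((W (u x) (deg f (g * h)%g s) (u s^-1%g * v h^-1%g)%g (u c))^-1
  * W (u x) (u f) (v (g * h)%g) (v h^-1%g)
  * W (u x) (u f * v (g * h)%g)%g (u s) (u s^-1%g * v h^-1%g)%g).
Qed.

Lemma comul_coef_actr f g c h s x :
  actr_coef f g c x * comul_coef f g (c * x)%g h s =
  comul_coef f g c h s * (w (deg f (g * h)%g s) (deg s^-1%g h^-1%g c) (u x))^-1
    * actr_coef s^-1%g h^-1%g c x.
Proof.
certificate (W (deg f (g * h)%g s) (u s^-1%g * v h^-1%g)%g (u c) (u x))^-1.
Qed.

(** The term h = g^-1 of the coproduct is the one the counit keeps. Its value does not depend on s,
    so summation over s only counts K. *)
Lemma comul_counitl f g c s :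
  comul_coef f g c g^-1%g s * b f s * actl_coef (f * s)%g s^-1%g g c = 1.
Proof. certificate (W (u f) (u s) (u s^-1%g) (v g) * (brel f s s^-1%g)^-1). Qed.

Lemma comul_counitr f g c s :
  comul_coef f g c 1%g s * b s^-1%g c * actr_coef f g s (s^-1 * c)%g = 1.
Proof.
certificate (brel s s^-1%g c * (W (u f * v g)%g (u s) (u s^-1%g) (u c))^-1).
Qed.

(** The two coefficients are reciprocal factor by factor once the group words are reduced, so the
    certificate is empty. *)
Lemma mul_comul_coef f g c h s :
  comul_coef f g c h s * mul_coef f (g * h)%g s s^-1%g h^-1%g c = 1.
Proof. certificate (1 : k). Qed.

(** The index of the coproduct on the left is written i h so that (i h)^-1 i = h^-1: both sides then
    multiply the same tensor. *)
Lemma frobenius_coefl f g c i d h s :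
  comul_coef f g c (i * h)%g s
    * (w (deg f (g * (i * h))%g s) (deg s^-1%g (i * h)^-1%g c) (deg c^-1%g i d))^-1
    * mul_coef s^-1%g (i * h)^-1%g c c^-1%g i d =
  mul_coef f g c c^-1%g i d * comul_coef f (g * i)%g d h s.
Proof.
certificate (W (deg f (g * i * h)%g s) (u s^-1%g * v (i * h)^-1%g)%g (u c) (u c^-1%g * v i)%g
  * (W (u f) (v (g * i * h)%g) (v (i * h)^-1%g) (v i))^-1
  * (W (deg f (g * i * h)%g s) (deg s^-1%g (i * h)^-1%g c) (u c^-1%g * v i)%g (u d))^-1
  * (W (u f * v (g * i * h)%g)%g (u s) (u s^-1%g * v (i * h)^-1%g)%g (v i))^-1
  * W (u s) (u s^-1%g) (v (i * h)^-1%g) (v i)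
  * prel (g * i * h)%g (i * h)^-1%g i).
Qed.

Lemma frobenius_coefr f g c i d h s :
  comul_coef c^-1%g i d h s
    * w (deg f g c) (deg c^-1%g (i * h)%g s) (deg s^-1%g h^-1%g d)
    * mul_coef f g c c^-1%g (i * h)%g s =
  mul_coef f g c c^-1%g i d * comul_coef f (g * i)%g d h s.
Proof.
certificate ((prel g (i * h)%g h^-1%g)^-1
  * W (deg f g c) (deg c^-1%g (i * h)%g s) (u s^-1%g * v h^-1%g)%g (u d)
  * W (u f) (v g) (v (i * h)%g) (v h^-1%g)
  * W (u f * v g)%g (u c) (u c^-1%g * v (i * h)%g)%g (v h^-1%g)
  * (W (deg f g c) (u c^-1%g * v (i * h)%g)%g (u s) (u s^-1%g * v h^-1%g)%g)^-1
  * (W (u c) (u c^-1%g) (v (i * h)%g) (v h^-1%g))^-1).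
Qed.

(** The label h i on the right matches splitting by h and then by i on the left; both iterated
    coproducts then carry the middle label i^-1. *)
Lemma comul_coefA f g c h s i t :
  comul_coef f g c h s * comul_coef f (g * h)%g s i t
    * (w (deg f (g * h * i)%g t) (deg t^-1%g i^-1%g s) (deg s^-1%g h^-1%g c))^-1 =
  comul_coef f g c (h * i)%g t * comul_coef t^-1%g (h * i)^-1%g c h s.
Proof.
certificate ((W (deg f (g * h * i)%g t) (deg t^-1%g i^-1%g s) (u s^-1%g * v h^-1%g)%g (u c))^-1
  * W (deg f (g * h * i)%g t) (u t^-1%g * v i^-1%g)%g (u s) (u s^-1%g * v h^-1%g)%g
  * (W (u f) (v (g * h * i)%g) (v i^-1%g) (v h^-1%g))^-1
  * (W (u f * v (g * h * i)%g)%g (u t) (u t^-1%g * v i^-1%g)%g (v h^-1%g))^-1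
  * W (u t) (u t^-1%g) (v i^-1%g) (v h^-1%g) * prel (g * h * i)%g i^-1%g h^-1%g).
Qed.

End HeckeCoefficients.

(** * The Frobenius algebra axioms for any data with a homogeneous basis and the given structure
    constants *)

Section HeckeAxioms.

Variables (k : fieldType) (gT KT LT : finGroupType).
Variables (w : gT -> gT -> gT -> k) (u : KT -> gT) (v : LT -> gT).
Variables (b : KT -> KT -> k) (p : LT -> LT -> k).
Hypothesis hc : hecke_cochains w u v b p.

Local Notation deg := (triple_deg u v).
Local Notation actl_coef := (actl_coef w u v b).
Local Notation actr_coef := (actr_coef w u v b).
Local Notation mul_coef := (mul_coef w u v b p).
Local Notation comul_coef := (comul_coef w u v b p).

Variables (A : valg k gT) (eA : KT -> A).
Hypothesis spA : gspan u eA.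
Hypothesis mulA : forall x y, vmul A (tens (eA x) (eA y)) = b x y *: eA (x * y)%g.
Hypothesis oneA : vone A 1 = eA 1%g.

Let gA : is_graded A. Proof. exact: gspan_graded spA. Qed.
Let hA x : homog (u x) (eA x). Proof. exact: spA.1. Qed.

Section Bimodule.

Variables (B : bimod A) (eH : KT -> LT -> KT -> B).
Hypothesis spH : gspan (fun i : KT * LT * KT => deg i.1.1 i.1.2 i.2)
  (fun i => eH i.1.1 i.1.2 i.2).
Hypothesis actlH : forall x f g c,
  actl B (tens (eA x) (eH f g c)) = actl_coef x f g c *: eH (x * f)%g g c.
Hypothesis actrH : forall f g c x,
  actr B (tens (eH f g c) (eA x)) = actr_coef f g c x *: eH f g (c * x)%g.

Let hH f g c : homog (deg f g c) (eH f g c). Proof. exact: (spH.1 (f, g, c)). Qed.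

Lemma hecke_is_bimod : is_bimod w B.
Proof.
split.
- split; first exact: gspan_graded spH.
    apply: gspan_graded_hom (gspan_tens spA spH) _ => -[x [[f g] c]].
    rewrite /fst /snd actlH -(deg_actl hc); exact/homogZ.
  apply: gspan_graded_hom (gspan_tens spH spA) _ => -[[[f g] c] x].
  rewrite /fst /snd actrH -(deg_actr hc); exact/homogZ.
- split.
    apply: (spans_tens (spans_tens spA.2 spA.2) spH.2) => -[[x y] [[f g] c]].
    rewrite /fst /snd; cbv beta; rewrite !comp_lfunE tmapE id_lfunE mulA tensZl lfunZ actlH.
    rewrite (vassocE w (hA x) (hA y) (hH f g c)) !lfunZ tmapE id_lfunE actlH.
    rewrite tensZr lfunZ actlH mulgA !scalerA; congr (_ *: _).
    by rewrite (actl_coefA hc) mulrA.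
  apply: (spans_tens (@spans_unit k gT) spH.2) => -[x [[f g] c]].
  rewrite /fst /snd; cbv beta; rewrite !comp_lfunE tmapE id_lfunE oneA actlH.
  rewrite (vlunitE w _ (hH f g c)) scale1r mul1g; congr (_ *: _).
  by rewrite (actl_coef1 hc); case: (w_normalized hc 1%g (deg f g c)) => -> _ _; rewrite invr1.
- split.
    apply: (spans_tens (spans_tens spH.2 spA.2) spA.2) => -[[[[f g] c] x] y].
    rewrite /fst /snd; cbv beta; rewrite !comp_lfunE tmapE id_lfunE actrH tensZl lfunZ actrH.
    rewrite (vassocE w (hH f g c) (hA x) (hA y)) !lfunZ tmapE id_lfunE mulA.
    rewrite tensZr lfunZ actrH mulgA !scalerA; congr (_ *: _).
    by rewrite (actr_coefA hc) mulrA.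
  apply: (spans_tens spH.2 (@spans_unit k gT)) => -[[[f g] c] x].
  rewrite /fst /snd; cbv beta; rewrite !comp_lfunE tmapE id_lfunE oneA actrH.
  rewrite (vrunitE w _ (hH f g c)) scale1r mulg1; congr (_ *: _).
  by rewrite (actr_coef1 hc); case: (w_normalized hc (deg f g c) 1%g) => _ -> _.
- apply: (spans_tens (spans_tens spA.2 spH.2) spA.2) => -[[x [[f g] c]] y].
  rewrite /fst /snd; cbv beta; rewrite !comp_lfunE tmapE id_lfunE actlH tensZl lfunZ actrH.
  rewrite (vassocE w (hA x) (hH f g c) (hA y)) !lfunZ tmapE id_lfunE actrH.
  rewrite tensZr lfunZ actlH !scalerA; congr (_ *: _).
  by rewrite (actlr_coef hc) mulrA.
Qed.

End Bimodule.

Variables (B : frob w A) (eH : KT -> LT -> KT -> B) (n nK nL : k).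
Hypothesis spH : gspan (fun i : KT * LT * KT => deg i.1.1 i.1.2 i.2)
  (fun i => eH i.1.1 i.1.2 i.2).
Hypothesis actlH : forall x f g c,
  actl B (tens (eA x) (eH f g c)) = actl_coef x f g c *: eH (x * f)%g g c.
Hypothesis actrH : forall f g c x,
  actr B (tens (eH f g c) (eA x)) = actr_coef f g c x *: eH f g (c * x)%g.
Hypothesis mulH : forall f g c f' g' c',
  amul B (btens w (eH f g c) (eH f' g' c')) =
    if f' == c^-1%g then mul_coef f g c c^-1%g g' c' *: eH f (g * g')%g c'
    else 0.
Hypothesis oneH : forall d,
  aone B (eA d) = \sum_s (b (d * s^-1)%g s)^-1 *: eH (d * s^-1)%g 1%g s.
Hypothesis comulH : forall f g c,
  comul B (eH f g c) = n *: \sum_h \sum_s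
    comul_coef f g c h s *:
      btens w (eH f (g * h)%g s) (eH s^-1%g h^-1%g c).
Hypothesis counitH : forall f g c,
  counit B (eH f g c) = ((g == 1%g)%:R * nL * b f c) *: eA (f * c)%g.
Hypotheses (nE : n = nK^-1 * nL^-1) (nK0 : nK != 0) (nL0 : nL != 0).
Hypotheses (nKE : nK = #|KT|%:R) (nLE : nL = #|LT|%:R).

Let hH f g c : homog (deg f g c) (eH f g c). Proof. exact: (spH.1 (f, g, c)). Qed.
Let bB : is_bimod w B. Proof. exact: hecke_is_bimod spH actlH actrH. Qed.
Let gB : is_graded B. Proof. exact: bimod_graded bB. Qed.
Let gBB := gspan_btens gA bB bB spH spH.
Let sBB := spans_btens (w := w) spH.2 spH.2.

Lemma mulH1 f g c g' c' : amul B (btens w (eH f g c) (eH c^-1%g g' c')) =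
  mul_coef f g c c^-1%g g' c' *: eH f (g * g')%g c'.
Proof. by rewrite mulH eqxx. Qed.

Lemma mulH0 f g c f' g' c' : f' != c^-1%g ->
  amul B (btens w (eH f g c) (eH f' g' c')) = 0.
Proof. by rewrite mulH => /negPf ->. Qed.

Lemma hecke_mul_hom : bimod_hom (amul B).
Proof.
split.
- apply: gspan_graded_hom gBB _ => -[[[f g] c] [[f' g'] c']].
  rewrite /fst /snd; cbv beta; rewrite mulH; case: eqP => [->|_]; last exact: homog0.
  rewrite -(deg_mul hc); exact/homogZ.
- apply: (spans_tens spA.2 sBB) => -[x [[[f g] c] [[f' g'] c']]].
  rewrite /fst /snd; cbv beta; rewrite [LHS]comp_lfunE [RHS]comp_lfunE tmapE id_lfunE.
  rewrite (actl_btens (w_cocycle hc) gA bB bB (hA x) (hH f g c) (hH f' g' c')).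
  rewrite actlH btensZl !lfunZ.
  case: (eqVneq f' c^-1%g) => [->|ne]; last first.
    by rewrite !mulH0 // tens0r lfun0 !scaler0.
  rewrite !mulH1 tensZr lfunZ actlH !scalerA; congr (_ *: _).
  by rewrite -(mul_coef_actl hc).
- apply: (spans_tens sBB spA.2) => -[[[[f g] c] [[f' g'] c']] x].
  rewrite /fst /snd; cbv beta; rewrite [LHS]comp_lfunE [RHS]comp_lfunE tmapE id_lfunE.
  rewrite (actr_btens (w_cocycle hc) gA bB bB (hH f g c) (hH f' g' c') (hA x)).
  rewrite actrH btensZr !lfunZ.
  case: (eqVneq f' c^-1%g) => [->|ne]; last first.
    by rewrite !mulH0 // tens0l lfun0 !scaler0.
  rewrite !mulH1 tensZl lfunZ actrH !scalerA; congr (_ *: _).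
  by rewrite -(mul_coef_actr hc).
Qed.

Lemma actl_bunitE x y : actl (bunit A) (tens (eA x) (eA y)) = b x y *: eA (x * y)%g.
Proof. exact: mulA. Qed.

Lemma actr_bunitE x y : actr (bunit A) (tens (eA x) (eA y)) = b x y *: eA (x * y)%g.
Proof. exact: mulA. Qed.

Lemma hecke_one_hom : bimod_hom (aone B).
Proof.
split.
- apply: (@gspan_graded_hom _ _ (bunit A) _ _ _ _ _ spA) => d.
  rewrite oneH; apply: homog_sum => s _; apply: homogZ.
  have -> : u d = deg (d * s^-1)%g 1%g s.
    by rewrite /triple_deg (morph_v1 hc) mulg1 -(u_morph hc) mulgKV.
  exact: hH.
- apply: (@spans_tens _ A (bunit A) _ _ _ _ spA.2 spA.2) => -[x d].
  rewrite /fst /snd; cbv beta; rewrite [LHS]comp_lfunE [RHS]comp_lfunE tmapE id_lfunE actl_bunitE lfunZ !oneH.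
  rewrite scaler_sumr tens_sumr lfun_sum; apply: eq_bigr => s _.
  by rewrite tensZr lfunZ actlH !scalerA (one_coef_actl hc) mulgA.
- apply: (@spans_tens _ (bunit A) A _ _ _ _ spA.2 spA.2) => -[d x].
  rewrite /fst /snd; cbv beta; rewrite [LHS]comp_lfunE [RHS]comp_lfunE tmapE id_lfunE actr_bunitE lfunZ !oneH.
  (* The unit at d x is summed over s x in place of s, which gives it the same first labels d s^-1
     as the unit at d. *)
  rewrite scaler_sumr tens_suml lfun_sum (reindex_inj (mulIg x)) /=.
  apply: eq_bigr => s _; rewrite tensZl lfunZ actrH !scalerA.
  by rewrite -(one_coef_actr hc) invMg mulgA mulgK.
Qed.

Lemma hecke_is_algebra : is_algebra B.
Proof.
have [mh oh] := (hecke_mul_hom, hecke_one_hom).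
have idh := @bimod_hom_id _ _ _ B.
have gBBg : is_graded (bten w B B) := gspan_graded gBB.
split=> //.
- apply: (spans_btens (w := w) sBB spH.2) => -[[[[f g] c] [[f' h] d]] [[f'' i] e]].
  rewrite /fst /snd; cbv beta; rewrite [LHS]comp_lfunE 2![RHS]comp_lfunE (bmapE w gA _ _ gBBg gB mh idh) id_lfunE.
  rewrite (bassocE (w_cocycle hc) gA bB bB bB (hH f g c) (hH f' h d) (hH f'' i e)) !lfunZ.
  rewrite (bmapE w gA _ _ gB gBBg idh mh) id_lfunE.
  case: (eqVneq f' c^-1%g) => [->|ne]; last first.
    rewrite mulH0 // btens0l lfun0; case: (eqVneq f'' d^-1%g) => [->|ne'].
      by rewrite mulH1 btensZr lfunZ mulH0 // !scaler0.
    by rewrite mulH0 // btens0r lfun0 scaler0.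
  rewrite mulH1 btensZl lfunZ; case: (eqVneq f'' d^-1%g) => [->|ne'].
    rewrite !mulH1 btensZr lfunZ mulH1 mulgA !scalerA (mul_coefA hc).
    by rewrite mulrA.
  by rewrite !mulH0 // btens0r lfun0 !scaler0.
- apply: (spans_btens (w := w) (M := bunit A) spA.2 spH.2) => -[x [[f g] c]].
  rewrite /fst /snd; cbv beta; rewrite [LHS]comp_lfunE (bmapE w gA (M := bunit A) _ _ gA gB oh idh).
  rewrite id_lfunE (blunitE gA _ _ bB) actlH oneH btens_suml lfun_sum.
  (* The summand with last label s composes with first label f only if f = s^-1. *)
  rewrite (sum_single (j := f^-1%g)) => [|s ne].
    rewrite btensZl lfunZ !invgK -[X in btens _ _ (eH X _ _)]invgK mulH1.
    by rewrite scalerA !invgK (mul_coef1l hc) mul1g.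
  rewrite btensZl lfunZ mulH0 ?scaler0 //.
  by apply: contra ne => /eqP ->; rewrite invgK.
- apply: (spans_btens (w := w) (N := bunit A) spH.2 spA.2) => -[[[f g] c] x].
  rewrite /fst /snd; cbv beta; rewrite [LHS]comp_lfunE (bmapE w gA (N := bunit A) _ _ gB gA idh oh).
  rewrite id_lfunE (brunitE gA _ _ bB) actrH oneH btens_sumr lfun_sum.
  have cx : (x * (c * x)^-1 = c^-1)%g by rewrite invMg mulKVg.
  (* Here the condition is x s^-1 = c^-1. *)
  rewrite (sum_single (j := (c * x)%g)) => [|s ne].
    by rewrite btensZr lfunZ cx mulH1 scalerA (mul_coef1r hc) mulg1.
  rewrite btensZr lfunZ mulH0 ?scaler0 //.
  by apply: contra ne => /eqP e; rewrite -[c]invgK -e invMg invgK mulgKV.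
Qed.

Let mh := hecke_mul_hom.
Let oh := hecke_one_hom.
Let idh : bimod_hom (\1 : 'Hom(B, B)) := bimod_hom_id (B : bimod A).
Let gBBg : is_graded (bten w B B) := gspan_graded gBB.

Lemma hecke_comul_hom : bimod_hom (comul B).
Proof.
split.
- apply: gspan_graded_hom spH _ => -[[f g] c]; rewrite /fst /snd comulH.
  apply/homogZ/homog_sum => h _; apply: homog_sum => s _; apply: homogZ.
  rewrite (deg_comul hc f g c h s); exact: homog_btens.
- apply: (spans_tens spA.2 spH.2) => -[x [[f g] c]].
  rewrite /fst /snd [LHS]comp_lfunE [RHS]comp_lfunE tmapE id_lfunE actlH lfunZ.
  rewrite !comulH tensZr lfunZ scalerA mulrC -scalerA; congr (_ *: _).
  rewrite tens_sumr lfun_sum scaler_sumr; apply: eq_bigr => h _.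
  rewrite tens_sumr lfun_sum scaler_sumr; apply: eq_bigr => s _.
  rewrite tensZr lfunZ.
  rewrite (actl_btens (w_cocycle hc) gA bB bB (hA x) (hH f (g * h)%g s) (hH _ _ _)).
  by rewrite actlH btensZl !scalerA (comul_coef_actl hc).
- apply: (spans_tens spH.2 spA.2) => -[[[f g] c] x].
  rewrite /fst /snd [LHS]comp_lfunE [RHS]comp_lfunE tmapE id_lfunE actrH lfunZ.
  rewrite !comulH tensZl lfunZ scalerA mulrC -scalerA; congr (_ *: _).
  rewrite tens_suml lfun_sum scaler_sumr; apply: eq_bigr => h _.
  rewrite tens_suml lfun_sum scaler_sumr; apply: eq_bigr => s _.
  rewrite tensZl lfunZ.
  rewrite (actr_btens (w_cocycle hc) gA bB bB (hH f (g * h)%g s) (hH _ _ _) (hA x)).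
  by rewrite actrH btensZr !scalerA (comul_coef_actr hc).
Qed.

Lemma hecke_counit_hom : bimod_hom (counit B).
Proof.
split.
- apply: gspan_graded_hom spH _ => -[[f g] c]; rewrite /fst /snd counitH.
  case: eqP => [->|_]; last by rewrite !mul0r scale0r; apply: homog0.
  apply: homogZ; rewrite /triple_deg (morph_v1 hc) mulg1 -(u_morph hc); exact: hA.
- apply: (spans_tens spA.2 spH.2) => -[x [[f g] c]].
  rewrite /fst /snd [LHS]comp_lfunE [RHS]comp_lfunE tmapE id_lfunE actlH lfunZ.
  rewrite !counitH tensZr lfunZ actl_bunitE !scalerA mulgA.
  case: (eqVneq g 1%g) => [->|_]; last by rewrite !mul0r mulr0 scale0r.
  by congr (_ *: _); rewrite mulrCA (counit_coef_actl hc) mulrA.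
- apply: (spans_tens spH.2 spA.2) => -[[[f g] c] x].
  rewrite /fst /snd [LHS]comp_lfunE [RHS]comp_lfunE tmapE id_lfunE actrH lfunZ.
  rewrite !counitH tensZl lfunZ actr_bunitE !scalerA mulgA.
  case: (eqVneq g 1%g) => [->|_]; last by rewrite !mul0r mulr0 scale0r.
  by congr (_ *: _); rewrite mulrCA (counit_coef_actr hc) mulrA.
Qed.

Lemma nK_nL : n * nK * nL = 1.
Proof. by rewrite nE; field; rewrite nK0 nL0. Qed.

Let dh := hecke_comul_hom.
Let eh := hecke_counit_hom.

(** The substitution h' = h i at fixed h, which aligns the summation indices of the two iterated
    coproducts. *)
Lemma sum_convolution (V : nmodType) (F : LT -> KT -> LT -> KT -> V) :
  \sum_h' \sum_t \sum_h \sum_s F h' t h s =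
  \sum_h \sum_s \sum_i \sum_t F (h * i)%g t h s.
Proof.
transitivity (\sum_h' \sum_h \sum_s \sum_t F h' t h s).
  apply: eq_bigr => h' _; rewrite exchange_big; apply: eq_bigr => h _.
  exact: exchange_big.
rewrite exchange_big; apply: eq_bigr => h _.
by rewrite (reindex_inj (mulgI h)) exchange_big.
Qed.

Lemma lfun_comul_l (U : vectType k) (F : 'Hom(bten w (bten w B B) B, U)) f g c y :
  F (btens w (comul B (eH f g c)) y) =
  n *: \sum_h \sum_s comul_coef f g c h s *:
    F (btens w (btens w (eH f (g * h)%g s) (eH s^-1%g h^-1%g c)) y).
Proof.
rewrite comulH btensZl lfunZ; congr (_ *: _).
rewrite btens_suml lfun_sum; apply: eq_bigr => h _.
rewrite btens_suml lfun_sum; apply: eq_bigr => s _.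
by rewrite btensZl lfunZ.
Qed.

Lemma lfun_comul_r (U : vectType k) (F : 'Hom(bten w B (bten w B B), U)) f g c x :
  F (btens w x (comul B (eH f g c))) =
  n *: \sum_h \sum_s comul_coef f g c h s *:
    F (btens w x (btens w (eH f (g * h)%g s) (eH s^-1%g h^-1%g c))).
Proof.
rewrite comulH btensZr lfunZ; congr (_ *: _).
rewrite btens_sumr lfun_sum; apply: eq_bigr => h _.
rewrite btens_sumr lfun_sum; apply: eq_bigr => s _.
by rewrite btensZr lfunZ.
Qed.

Lemma lfun_comul (U : vectType k) (F : 'Hom(bten w B B, U)) f g c :
  F (comul B (eH f g c)) =
  n *: \sum_h \sum_s comul_coef f g c h s *:
    F (btens w (eH f (g * h)%g s) (eH s^-1%g h^-1%g c)).
Proof.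
rewrite comulH lfunZ; congr (_ *: _).
rewrite lfun_sum; apply: eq_bigr => h _.
by rewrite lfun_sum; apply: eq_bigr => s _; rewrite lfunZ.
Qed.

Lemma hecke_is_coalgebra : is_coalgebra B.
Proof.
split=> //.
- apply: spH.2 => -[[f g] c]; rewrite /fst /snd.
  rewrite 2![LHS]comp_lfunE [RHS]comp_lfunE.
  pose F := (bassoc w B B B \o bmap w (comul B) \1)%VF.
  rewrite -[LHS]/(bassoc w B B B (bmap w (comul B) \1 _)) -comp_lfunE -/F.
  rewrite !lfun_comul; congr (_ *: _).
  transitivity (\sum_h \sum_s n *: \sum_i \sum_t
    (comul_coef f g c h s * comul_coef f (g * h)%g s i t
    * (w (deg f (g * h * i)%g t) (deg t^-1%g i^-1%g s) (deg s^-1%g h^-1%g c))^-1)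
    *: btens w (eH f (g * h * i)%g t)
         (btens w (eH t^-1%g i^-1%g s) (eH s^-1%g h^-1%g c))).
    apply: eq_bigr => h _; apply: eq_bigr => s _.
    rewrite /F [X in _ *: X = _]comp_lfunE (bmapE w gA _ _ gB gB dh idh) id_lfunE.
    rewrite lfun_comul_l scalerA mulrC -scalerA; congr (_ *: _).
    rewrite scaler_sumr; apply: eq_bigr => i _.
    rewrite scaler_sumr; apply: eq_bigr => t _.
    rewrite (bassocE (w_cocycle hc) gA bB bB bB (hH _ _ _) (hH _ _ _) (hH _ _ _)).
    by rewrite !scalerA mulrA.
  transitivity (n *: \sum_h' \sum_t \sum_h \sum_s
    (comul_coef f g c h' t * comul_coef t^-1%g h'^-1%g c h s)
    *: btens w (eH f (g * h')%g t)
         (btens w (eH t^-1%g (h'^-1 * h)%g s) (eH s^-1%g h^-1%g c))).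
    rewrite sum_convolution scaler_sumr; apply: eq_bigr => h _.
    rewrite scaler_sumr; apply: eq_bigr => s _; congr (_ *: _).
    apply: eq_bigr => i _; apply: eq_bigr => t _.
    by rewrite (comul_coefA hc) invMg mulgKV mulgA.
  rewrite scaler_sumr; apply: eq_bigr => h' _.
  rewrite scaler_sumr; apply: eq_bigr => t _.
  rewrite (bmapE w gA _ _ gB gB idh dh) id_lfunE.
  rewrite comulH btensZr scalerA mulrC -scalerA; congr (_ *: _).
  rewrite btens_sumr scaler_sumr; apply: eq_bigr => h _.
  rewrite btens_sumr scaler_sumr; apply: eq_bigr => s _.
  by rewrite btensZr scalerA.
- apply: spH.2 => -[[f g] c]; rewrite /fst /snd 2!comp_lfunE id_lfunE.
  pose F := (blunit w B \o bmap w (counit B) \1)%VF.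
  rewrite -comp_lfunE -/F lfun_comul.
  (* The counit forces g h = 1; the surviving terms are independent of s, and their number |K|
     together with the factor |L| of the counit cancels [n]. *)
  have FE h s : comul_coef f g c h s *:
      F (btens w (eH f (g * h)%g s) (eH s^-1%g h^-1%g c)) =
      if h == g^-1%g then nL *: eH f g c else 0.
    rewrite /F [X in _ *: X]comp_lfunE (bmapE w gA _ _ gB gB eh idh) id_lfunE.
    rewrite counitH btensZl lfunZ (blunitE gA _ _ bB) actlH !scalerA mulgK.
    rewrite -eq_invg_mul eq_sym; case: eqP => [->|_]; last first.
      by rewrite !mul0r mulr0 mul0r scale0r.
    rewrite invgK mul1r; congr (_ *: _).
    by rewrite -[RHS]mulr1 -(comul_counitl hc f g c s); ring.
  rewrite (sum_single (j := g^-1%g)) => [|h /negPf ne]; last first.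
    by apply: big1 => s _; rewrite FE ne.
  under eq_bigr => s _ do rewrite FE eqxx.
  by rewrite sumr_const -scaler_nat -nKE !scalerA nK_nL scale1r.
- apply: spH.2 => -[[f g] c]; rewrite /fst /snd 2!comp_lfunE id_lfunE.
  pose F := (brunit w B \o bmap w \1 (counit B))%VF.
  rewrite -comp_lfunE -/F lfun_comul.
  have FE h s : comul_coef f g c h s *:
      F (btens w (eH f (g * h)%g s) (eH s^-1%g h^-1%g c)) =
      if h == 1%g then nL *: eH f g c else 0.
    rewrite /F [X in _ *: X]comp_lfunE (bmapE w gA _ _ gB gB idh eh) id_lfunE.
    rewrite counitH btensZr lfunZ (brunitE gA _ _ bB) actrH !scalerA mulKVg.
    rewrite invg_eq1; case: eqP => [->|_]; last first.
      by rewrite !mul0r mulr0 mul0r scale0r.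
    rewrite mulg1 mul1r; congr (_ *: _).
    by rewrite -[RHS]mulr1 -(comul_counitr hc f g c s); ring.
  rewrite (sum_single (j := 1%g)) => [|h /negPf ne]; last first.
    by apply: big1 => s _; rewrite FE ne.
  under eq_bigr => s _ do rewrite FE eqxx.
  by rewrite sumr_const -scaler_nat -nKE !scalerA nK_nL scale1r.
Qed.

Lemma hecke_frobeniusl :
  (bmap w \1 (amul B) \o bassoc w B B B \o bmap w (comul B) \1
    = comul B \o amul B)%VF.
Proof.
apply: sBB => -[[[f g] c] [[f' i] d]]; rewrite /fst /snd; cbv beta.
pose F := (bmap w \1 (amul B) \o bassoc w B B B)%VF.
have FE h s : F (btens w (btens w (eH f (g * h)%g s) (eH s^-1%g h^-1%g c))
      (eH f' i d)) =
    if f' == c^-1%g then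
      ((w (deg f (g * h)%g s) (deg s^-1%g h^-1%g c) (deg c^-1%g i d))^-1 *
      mul_coef s^-1%g h^-1%g c c^-1%g i d) *:
      btens w (eH f (g * h)%g s) (eH s^-1%g (h^-1 * i)%g d) else 0.
  rewrite [LHS]comp_lfunE.
  rewrite (bassocE (w_cocycle hc) gA bB bB bB (hH _ _ _) (hH _ _ _) (hH _ _ _)).
  rewrite lfunZ (bmapE w gA _ _ gB gBBg idh mh) id_lfunE.
  case: (eqVneq f' c^-1%g) => [->|ne]; first by rewrite mulH1 btensZr scalerA.
  by rewrite mulH0 // btens0r scaler0.
rewrite [LHS]comp_lfunE [RHS]comp_lfunE (bmapE w gA _ _ gB gB dh idh) id_lfunE.
rewrite -/F lfun_comul_l; case: (eqVneq f' c^-1%g) FE => [->|ne] FE; last first.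
  rewrite mulH0 // lfun0 big1 ?scaler0 // => h _; rewrite big1 // => s _.
  by rewrite FE scaler0.
rewrite mulH1 lfunZ comulH scalerA mulrC -scalerA; congr (_ *: _).
(* The coproduct of the first factor is summed over i h, as [frobenius_coefl] requires. *)
rewrite scaler_sumr (reindex_inj (mulgI i)); apply: eq_bigr => h _.
rewrite scaler_sumr; apply: eq_bigr => s _.
rewrite FE !scalerA -(frobenius_coefl hc) !mulrA mulgA.
by rewrite invMg mulgKV.
Qed.

Lemma hecke_frobeniusr :
  (comul B \o amul B
    = bmap w (amul B) \1 \o bassocV w B B B \o bmap w \1 (comul B))%VF.
Proof.
apply: sBB => -[[[f g] c] [[f' i] d]]; rewrite /fst /snd; cbv beta.
pose F := (bmap w (amul B) \1 \o bassocV w B B B)%VF.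
have FE h s : F (btens w (eH f g c)
      (btens w (eH f' (i * h)%g s) (eH s^-1%g h^-1%g d))) =
    if f' == c^-1%g then
      (w (deg f g c) (deg c^-1%g (i * h)%g s) (deg s^-1%g h^-1%g d) *
      mul_coef f g c c^-1%g (i * h)%g s) *:
      btens w (eH f (g * (i * h))%g s) (eH s^-1%g h^-1%g d) else 0.
  rewrite [LHS]comp_lfunE.
  rewrite (bassocVE (w_cocycle hc) gA bB bB bB (hH _ _ _) (hH _ _ _) (hH _ _ _)).
  rewrite lfunZ (bmapE w gA _ _ gBBg gB mh idh) id_lfunE.
  case: (eqVneq f' c^-1%g) => [->|ne]; first by rewrite mulH1 btensZl scalerA.
  by rewrite mulH0 // btens0l scaler0.
rewrite [LHS]comp_lfunE [RHS]comp_lfunE (bmapE w gA _ _ gB gB idh dh) id_lfunE.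
rewrite -/F lfun_comul_r; case: (eqVneq f' c^-1%g) FE => [->|ne] FE; last first.
  rewrite mulH0 // lfun0 big1 ?scaler0 // => h _; rewrite big1 // => s _.
  by rewrite FE scaler0.
rewrite mulH1 lfunZ comulH scalerA mulrC -scalerA; congr (_ *: _).
rewrite scaler_sumr; apply: eq_bigr => h _.
rewrite scaler_sumr; apply: eq_bigr => s _.
by rewrite FE !scalerA -(frobenius_coefr hc) !mulrA mulgA.
Qed.

(** Reciprocal coefficients make each of the |K||L| summands return the original basis vector, and
    [n] is the inverse of their number. *)
Lemma hecke_mul_comul : (amul B \o comul B = \1)%VF.
Proof.
apply: spH.2 => -[[f g] c]; rewrite /fst /snd comp_lfunE id_lfunE lfun_comul.
rewrite (eq_bigr (fun=> nK *: eH f g c)) => [|h _]; last first.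
  rewrite (eq_bigr (fun=> eH f g c)) => [|s _].
    by rewrite sumr_const -scaler_nat nKE.
  rewrite mulH1 scalerA (mul_comul_coef hc) scale1r.
  by rewrite -mulgA mulgV mulg1.
rewrite sumr_const -scaler_nat -nLE !scalerA.
by have -> : n * (nL * nK) = 1 by [rewrite -[RHS]nK_nL; ring]; rewrite scale1r.
Qed.

(** The value of b in the counit cancels the one in the unit, so each s in K contributes |L|. *)
Lemma hecke_counit_one : (counit B \o aone B = (nK * nL) *: \1)%VF.
Proof.
apply: spA.2 => d; rewrite comp_lfunE scale_lfunE id_lfunE oneH lfun_sum.
under eq_bigr => s _ do rewrite lfunZ counitH eqxx mul1r mulgKV scalerA
  mulrCA mulVf ?(b_neq0 hc) // mulr1.
by rewrite sumr_const -scaler_nat scalerA nKE.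
Qed.

Lemma hecke_is_frobenius : is_frobenius B.
Proof.
split; [exact: hecke_is_algebra | exact: hecke_is_coalgebra | |].
- exact: hecke_frobeniusl.
- exact: hecke_frobeniusr.
Qed.

Lemma hecke_special : special B.
Proof.
split; [exact: hecke_is_frobenius | exact: hecke_mul_comul |].
exists (nK * nL); [by rewrite mulf_neq0 | exact: hecke_counit_one].
Qed.

Lemma hecke_separable : separable B.
Proof.
split; first exact: hecke_is_algebra.
exists (comul B); split; [exact: dh | exact: hecke_mul_comul | |].
- exact: hecke_frobeniusl.
- exact: hecke_frobeniusr.
Qed.

Lemma hecke_central_scalar (F : 'Hom(B, B)) : graded_hom F ->
    (forall x y, F (amul B (btens w x y)) = amul B (btens w (F x) y)) ->
    (forall x y, F (amul B (btens w x y)) = amul B (btens w x (F y))) ->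
  exists c : k, F = c *: \1%VF.
Proof.
move=> gF Fl Fr; pose e := eH 1%g 1%g 1%g.
(* Compression to the corner at [e], followed by projection to degree 1. Being a linear map, its
   image can be found from its values on the basis. *)
pose Q := (gpr B 1%g \o (amul B \o (bpi w B B \o tensl B e))
  \o (amul B \o (bpi w B B \o tensr B e)))%VF.
have QE y : Q y = gpr B 1%g (amul B (btens w e (amul B (btens w y e)))).
  by rewrite !comp_lfunE tenslE tensrE.
have mul1 f g c : amul B (btens w (eH f g 1%g) (eH 1%g 1%g c)) = eH f g c.
  by rewrite -[X in eH X 1%g c]invg1 mulH1 invg1 (mul_coef11 hc) scale1r mulg1.
have Qe y : Q y \in <[e]>%VS.
  (* Membership for all y is recast as an equality of linear maps, to be checked on the basis. *)
  suff ->: Q = (projv <[e]> \o Q)%VF by rewrite comp_lfunE memv_proj.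
  apply: spH.2 => -[[f g] c]; rewrite /fst /snd [RHS]comp_lfunE.
  apply/esym/projv_id; rewrite QE.
  case: (eqVneq c 1%g) => [->|nc]; last first.
    rewrite mulH0 ?btens0r ?lfun0 ?mem0v //.
    by apply: contra nc => /eqP e1; rewrite -[c]invgK -e1 invg1.
  rewrite [amul B (btens w _ e)]mul1.
  case: (eqVneq f 1%g) => [->|nf]; last first.
    by rewrite mulH0 ?lfun0 ?mem0v ?invg1.
  rewrite -[X in eH X g 1%g]invg1 mulH1 lfunZ mul1g memvZ // hH.
  case: eqP => [dg|_]; last exact: mem0v.
  (* The corner is spanned by the vectors [eH 1 g 1], of degree [v g]; degree 1 leaves only g =
     1. *)
  rewrite (_ : g = 1%g) ?memv_line //; apply: (v_inj hc).
  by move: dg; rewrite /triple_deg (morph_v1 hc) (morph_u1 hc) mul1g mulg1.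
have he : homog 1%g e.
  have -> : 1%g = deg 1%g 1%g 1%g :> gT; last exact: hH.
  by rewrite /triple_deg (morph_v1 hc) (morph_u1 hc) !mulg1.
have Fe : F e = Q (F e).
  rewrite QE -Fl mul1 -Fr mul1.
  by rewrite (graded_hom_homog gF he) eqxx.
have /vlineP[c Ec] : F e \in <[e]>%VS by rewrite Fe.
exists c; apply: spH.2 => -[[f g] x]; rewrite /fst /snd scale_lfunE id_lfunE.
(* The basis vector is factored as [eH f g 1] times [e] times [eH 1 1 x], and F is moved onto the
   middle factor. *)
rewrite -{1}(mul1 f g x) Fl -{1}(mul1 f g 1%g) Fr [F _]Ec btensZr lfunZ btensZl.
by rewrite lfunZ !mul1.
Qed.

End HeckeAxioms.

(** * Direct sums of algebras and the criterion for indecomposability *)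

Section Decomposition.

Variables (k : fieldType) (gT : finGroupType) (w : gT -> gT -> gT -> k).
Variable A : valg k gT.
Hypothesis gA : is_graded A.

Lemma graded_gsum (V W : gvec k gT) :
  is_graded V -> is_graded W -> is_graded (gsum V W).
Proof.
move=> [oV sV] [oW sW]; split=> [g h|].
  apply/lfunP => -[x y]; rewrite comp_lfunE !pairmE !comp_lfunE !fstmE !sndmE.
  rewrite -[gpr V g _]comp_lfunE -[gpr W g _]comp_lfunE oV oW.
  case: eqP => [->|_]; last by rewrite !zero_lfunE.
  by rewrite pairmE !comp_lfunE fstmE sndmE.
apply/lfunP => -[x y]; rewrite id_lfunE sum_lfunE.
rewrite (eq_bigr (fun g => (gpr V g x, gpr W g y) : (V * W)%type)) => [|g _].
  have := (sV, sW) => -[/lfunP/(_ x) + /lfunP/(_ y)].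
  rewrite !sum_lfunE !id_lfunE => ex ey.
  have sumE I (r : seq I) (a : I -> V) (c : I -> W) :
      \sum_(i <- r) ((a i, c i) : (V * W)%type) = (\sum_(i <- r) a i, \sum_(i <- r) c i).
    by elim: r => [|i r IH]; rewrite ?big_nil // !big_cons IH.
  by rewrite sumE ex ey.
by rewrite pairmE !comp_lfunE fstmE sndmE.
Qed.

Lemma bfst_hom (M N : bimod A) : bimod_hom (bfst M N).
Proof.
split=> [g||].
- by apply/lfunP => x; rewrite !comp_lfunE [LHS]fstmE pairmE comp_lfunE.
- by apply/lfunP => x; rewrite !comp_lfunE [LHS]fstmE pairmE comp_lfunE.
- by apply/lfunP => x; rewrite !comp_lfunE [LHS]fstmE pairmE comp_lfunE.
Qed.

Lemma bsnd_hom (M N : bimod A) : bimod_hom (bsnd M N).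
Proof.
split=> [g||].
- by apply/lfunP => x; rewrite !comp_lfunE [LHS]sndmE pairmE !comp_lfunE.
- by apply/lfunP => x; rewrite !comp_lfunE [LHS]sndmE pairmE !comp_lfunE.
- by apply/lfunP => x; rewrite !comp_lfunE [LHS]sndmE pairmE !comp_lfunE.
Qed.

Lemma central_scalar_indecomposable (B : alg w A) :
    is_algebra B ->
    (forall F : 'Hom(B, B), graded_hom F ->
      (forall x y, F (amul B (btens w x y)) = amul B (btens w (F x) y)) ->
      (forall x y, F (amul B (btens w x y)) = amul B (btens w x (F y))) ->
      exists c : k, F = c *: \1%VF) ->
  indecomposable B.
Proof.
move=> algB central; split=> // -[B1 [B2 [alg1 alg2 nt1 nt2]]].
move=> [f [g [hf hg gf fg]]].
have [[bB _ _] _ _ _] := algB.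
have [[b1 _ _] _ _ _] := alg1; have [[b2 _ _] _ _ _] := alg2.
have g12 : is_graded (alg_sum B1 B2).
  exact: graded_gsum (bimod_graded b1) (bimod_graded b2).
have gfK x : g (f x) = x by rewrite -comp_lfunE gf id_lfunE.
have fgK x : f (g x) = x by rewrite -comp_lfunE fg id_lfunE.
have fM x y : f (amul B (btens w x y)) =
    (amul B1 (btens w (f x).1 (f y).1), amul B2 (btens w (f x).2 (f y).2)).
  have [fh /lfunP/(_ (btens w x y)) + _] := hf.
  rewrite [LHS]comp_lfunE [RHS]comp_lfunE => ->.
  rewrite (bmapE w gA _ _ (bimod_graded bB) (bimod_graded bB) fh fh).
  rewrite pairmE; congr (_, _); rewrite [LHS]comp_lfunE.
    rewrite (bmapE w gA _ _ g12 g12 (bfst_hom B1 B2) (bfst_hom B1 B2)).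
    by congr (amul B1 (btens w _ _)); apply: fstmE.
  rewrite (bmapE w gA _ _ g12 g12 (bsnd_hom B1 B2) (bsnd_hom B1 B2)).
  by congr (amul B2 (btens w _ _)); apply: sndmE.
pose e1 : 'End((B1 * B2)%type) := pairm (fstm B1 B2) 0.
have e1E x : e1 x = (x.1, 0) by rewrite pairmE fstmE zero_lfunE.
(* The projection onto the first summand, transported to [B]. It commutes with multiplications
   because the product of the sum is componentwise ([fM]) and kills a zero component. *)
pose F : 'Hom(B, B) := (g \o (e1 : 'Hom(alg_sum B1 B2, alg_sum B1 B2)) \o f)%VF.
have fF x : f (F x) = ((f x).1, 0) by rewrite !comp_lfunE fgK e1E.
have finj : injective f by apply: can_inj gfK.
have [|||c Fc] := central F.
- have [[gf' _ _] _ _] := hf; have [[gg' _ _] _ _] := hg.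
  move=> h; apply/lfunP => x; rewrite [LHS]comp_lfunE [RHS]comp_lfunE.
  apply: finj; rewrite fF.
  have fgpr y : f (gpr B h y) = (gpr B1 h (f y).1, gpr B2 h (f y).2).
    have /lfunP/(_ y) := gf' h; rewrite [LHS]comp_lfunE [RHS]comp_lfunE => ->.
    by rewrite pairmE !comp_lfunE fstmE sndmE.
  by rewrite !fgpr fF /= linear0.
- move=> x y; apply: finj; rewrite fF !fM fF /=.
  by rewrite btens0l lfun0.
- move=> x y; apply: finj; rewrite fF !fM fF /=.
  by rewrite btens0r lfun0.
(* A nonzero vector of the first summand forces c = 1, one of the second forces c = 0. *)
have E x : (x.1, 0) = c *: x :> (B1 * B2)%type.
  by rewrite -{1}[x]fgK -fF Fc scale_lfunE id_lfunE lfunZ fgK.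
have nz (V : vectType k) : \dim {:V} != 0%N -> exists2 x : V, x != 0 & True.
  move=> nV; exists (vpick {:V}) => //; apply: contra nV => /eqP/eqP.
  by rewrite vpick0 => /eqP ->; rewrite dimv0.
have [x1 x10 _] := nz _ nt1; have [x2 x20 _] := nz _ nt2.
have [/eqP] := E (x1, 0); rewrite -subr_eq0 -{1}[x1]scale1r -scalerBl.
rewrite scaler_eq0 (negPf x10) orbF subr_eq0 => /eqP c1 _.
have [_ /esym/eqP] := E (0, x2).
by rewrite -c1 scale1r (negPf x20).
Qed.

End Decomposition.

(** * The twisted group algebra on its homogeneous basis *)

Section TwistedAlgebra.

Variables (k : fieldType) (gT : finGroupType).
Variables (N : {group gT}) (t : gT -> gT -> k).

Local Notation del := (@delta k gT N).

Lemma sum_delta (a : {ffun subg_of N -> k^o}) : a = \sum_x (a x : k) *: del x.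
Proof.
apply/ffunP => y; rewrite sum_ffunE (sum_single (j := y)) => [|x ne].
  by rewrite !ffunE eqxx -[RHS]/(_ * _) mulr1.
by rewrite !ffunE eq_sym (negPf ne) scaler0.
Qed.

Lemma gspan_delta : gspan (@sgval gT N) del.
Proof.
split=> [x g|U F G FG]; last first.
  by apply/lfunP => a; rewrite [a]sum_delta !lfun_sum; apply: eq_bigr => x _;
    rewrite !lfunZ FG.
rewrite linfunE => [|c a d]; apply/ffunP => y; rewrite !ffunE; last first.
  by case: eqP => // _; rewrite scaler0 addr0.
case: (eqVneq y x) => [->|ne]; rewrite ?if_same ?(eq_sym g).
  by case: eqP; rewrite !ffunE ?eqxx.
by case: eqP; rewrite !ffunE ?(negPf ne).
Qed.

Lemma twisted_mulE x y : vmul (twisted_alg N t) (tens (del x) (del y)) =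
  t (sgval x) (sgval y) *: del (x * y)%g.
Proof.
rewrite tliftE => [|b c a d|a c b d].
- rewrite (sum_single (j := x)) => [|i ne].
    rewrite (sum_single (j := y)) => [|i ne].
      by rewrite !ffunE !eqxx mulr1 scale1r.
    by rewrite !ffunE (negPf ne) mulr0 scale0r.
  by rewrite big1 // => j _; rewrite !ffunE (negPf ne) mul0r scale0r.
- rewrite scaler_sumr -big_split; apply: eq_bigr => i _ /=.
  rewrite scaler_sumr -big_split; apply: eq_bigr => j _ /=.
  by rewrite !ffunE [c *: (_ *: _)]scalerA -scalerDl mulrDl mulrA.
- rewrite scaler_sumr -big_split; apply: eq_bigr => i _ /=.
  rewrite scaler_sumr -big_split; apply: eq_bigr => j _ /=.
  by rewrite !ffunE [c *: (_ *: _)]scalerA -scalerDl mulrDr mulrCA.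
Qed.

Lemma twisted_oneE : vone (twisted_alg N t) 1 = del 1%g.
Proof.
rewrite linfunE ?scale1r // => c a d.
by rewrite scalerDl scalerA.
Qed.

End TwistedAlgebra.

(** * The twisted Hecke algebra satisfies the abstract hypotheses *)

Section HeckeInstance.

Variables (k : fieldType) (gT : finGroupType) (w : gT -> gT -> gT -> k).
Variables (K L : {group gT}) (beta psi : gT -> gT -> k).
Hypotheses (wcocycle : cocycle3 w) (wnorm : normalized3 w).
Hypotheses (betaK : cochain2 K beta) (betanorm : normalized2 K beta).
Hypothesis dbeta : trivializes K beta w.
Hypotheses (psiL : cochain2 L psi) (psinorm : normalized2 L psi).
Hypothesis dpsi : trivializes L psi w.

Local Notation A := (twisted_alg K beta).
Local Notation H := (hecke_bimod w K L beta psi).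
Local Notation hb := (@hbasis k gT w K L beta psi).
Local Notation u := (@sgval gT K).
Local Notation v := (@sgval gT L).
Let b (x y : subg_of K) := beta (sgval x) (sgval y).
Let p (x y : subg_of L) := psi (sgval x) (sgval y).

Lemma sgval_mul (N : {group gT}) (x y : subg_of N) :
  sgval (x * y)%g = (sgval x * sgval y)%g.
Proof. by rewrite sgvalM ?in_setT. Qed.

Lemma sgval_inv (N : {group gT}) (x : subg_of N) : sgval x^-1%g = (sgval x)^-1%g.
Proof. by rewrite morphV ?in_setT. Qed.

Lemma sgval_inj (N : {group gT}) : injective (@sgval gT N).
Proof. exact: val_inj. Qed.

Lemma hecke_cochains_sgval : hecke_cochains w u v b p.
Proof.
split=> //; try exact: sgval_mul.
- exact: sgval_inj.
- by move=> x y; apply: betaK; apply: subgP.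
- by move=> x y; apply: psiL; apply: subgP.
- by move=> x; apply: betanorm; apply: subgP.
- by move=> x; apply: psinorm; apply: subgP.
- by move=> x y z; rewrite /b !sgval_mul; apply: dbeta; apply: subgP.
- by move=> x y z; rewrite /p !sgval_mul; apply: dpsi; apply: subgP.
Qed.

Let spK := gspan_delta k K.
Let spL := gspan_delta k L.

Lemma gspan_hbasis :
  gspan (V := H) (fun i : subg_of K * subg_of L * subg_of K =>
    triple_deg u v i.1.1 i.1.2 i.2) (fun i => hb i.1.1 i.1.2 i.2).
Proof. exact: gspan_tens (gspan_tens spK spL) spK. Qed.

Lemma actl_hbasis x f g c :
  actl H (tens (delta k x) (hb f g c)) =
    actl_coef w u v b x f g c *: hb (x * f)%g g c.
Proof.
rewrite [LHS]comp_lfunE.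
rewrite (vassocVE w (spK.1 x) (homog_tens (spK.1 f) (spL.1 g)) (spK.1 c)).
rewrite lfunZ tmapE id_lfunE comp_lfunE.
rewrite (vassocVE w (spK.1 x) (spK.1 f) (spL.1 g)) lfunZ tmapE id_lfunE.
by rewrite twisted_mulE !tensZl !scalerA mulrA.
Qed.

Lemma actr_hbasis f g c x :
  actr H (tens (hb f g c) (delta k x)) =
    actr_coef w u v b f g c x *: hb f g (c * x)%g.
Proof.
rewrite [LHS]comp_lfunE.
rewrite (vassocE w (homog_tens (spK.1 f) (spL.1 g)) (spK.1 c) (spK.1 x)).
rewrite lfunZ tmapE id_lfunE.
by rewrite twisted_mulE !tensZr !scalerA.
Qed.

(** Linearity in the table of prescribed values. In [hmul0] the table of the outer [hlift] depends
    on the second factor, so bilinearity of the product rests on this. *)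
Lemma hlift_linear (U : vectType k) c x
    (F G E : subg_of K -> subg_of L -> subg_of K -> U) :
    (forall f g l, E f g l = c *: F f g l + G f g l) ->
  hlift w beta psi E x = c *: hlift w beta psi F x + hlift w beta psi G x.
Proof.
move=> EFG; rewrite -scale_lfunE -add_lfunE; congr (fun_of_lfun _ x).
apply: gspan_hbasis.2 => -[[f g] l]; rewrite /fst /snd.
by rewrite add_lfunE scale_lfunE !hliftE.
Qed.

Lemma hmul0E f g c f' g' c' :
  hmul0 w K L beta psi (tens (hb f g c) (hb f' g' c')) =
    if f' == c^-1%g then
      mul_coef w u v b p f g c c^-1%g g' c' *: hb f (g * g')%g c' else 0.
Proof.
rewrite tliftE => [|y a x x'|x a y y']; last 2 first.
- by rewrite linearP.
- by apply: hlift_linear => ? ? ?; rewrite linearP.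
rewrite !hliftE /=.
have -> : (sgval c * sgval f' == 1)%g = (f' == c^-1)%g.
  apply/eqP/eqP => [e|->]; last by rewrite sgval_inv mulgV.
  apply: sgval_inj; rewrite sgval_inv.
  by apply: (mulgI (sgval c)); rewrite e mulgV.
case: eqP => [->|_]; last by rewrite !mul0r scale0r.
by rewrite mul1r.
Qed.

(* hmul0 is balanced over A, so it can be evaluated on any representative. *)
Lemma hmulE f g c f' g' c' :
  hmul w K L beta psi (btens w (hb f g c) (hb f' g' c')) =
    if f' == c^-1%g then
      mul_coef w u v b p f g c c^-1%g g' c' *: hb f (g * g')%g c' else 0.
Proof.
have hc := hecke_cochains_sgval.
rewrite -hmul0E [LHS]comp_lfunE; apply: bsec_btens.
apply: (bdiff_comp0_basis gspan_hbasis spK gspan_hbasis).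
move=> [[f1 g1] c1] x [[f2 g2] c2]; rewrite /fst /snd.
rewrite actr_hbasis actl_hbasis tensZl tensZr !lfunZ !hmul0E.
have -> : (x * f2 == c1^-1)%g = (f2 == (c1 * x)^-1)%g.
  by rewrite -(inj_eq (mulgI x^-1%g)) mulKg invMg.
case: eqP => [->|_]; last by rewrite !scaler0.
by rewrite !scalerA (mul_coef_mid hc) mulrA.
Qed.

Lemma honeE d : hone w K L beta psi (delta k d) =
  \sum_s (b (d * s^-1)%g s)^-1 *: hb (d * s^-1)%g 1%g s.
Proof.
rewrite linfunE => [|c x y].
  rewrite (sum_single (j := d)) => [|i ne].
    by rewrite !ffunE eqxx scale1r; apply: eq_bigr => s _;
      rewrite /b sgval_mul sgval_inv.
  by rewrite !ffunE (negPf ne) scale0r.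
rewrite scaler_sumr -big_split; apply: eq_bigr => i _ /=.
by rewrite !ffunE [c *: (_ *: _)]scalerA -scalerDl.
Qed.

Lemma hcomulE f g c : hcomul w K L beta psi (hb f g c) =
  (#|K|%:R^-1 * #|L|%:R^-1) *: \sum_h \sum_s
    comul_coef w u v b p f g c h s *:
      btens w (hb f (g * h)%g s) (hb s^-1%g h^-1%g c).
Proof.
by rewrite hliftE; congr (_ *: _); apply: eq_bigr => h _; apply: eq_bigr.
Qed.

Lemma hcounitE f g c : hcounit w K L beta psi (hb f g c) =
  ((g == 1%g)%:R * #|L|%:R * b f c) *: delta k (f * c)%g.
Proof. exact: hliftE. Qed.

Lemma card_subg_of (N : {group gT}) : #|{: subg_of N}| = #|N|.
Proof. by rewrite card_sub; apply: eq_card. Qed.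

Lemma hecke_properties : [pchar k] =i pred0 ->
  [/\ indecomposable (hecke w K L beta psi),
      special (hecke w K L beta psi)
    & separable (hecke w K L beta psi)].
Proof.
move=> /pcharf0P char0.
(* Characteristic 0 makes |K| and |L| invertible, hence the prefactor of the coproduct cancels the
   counts and phi is nonzero. *)
have card0 (N : {group gT}) : #|N|%:R != 0 :> k.
  by rewrite char0 -lt0n cardG_gt0.
have hc := hecke_cochains_sgval.
have cK : #|K|%:R = #|{: subg_of K}|%:R :> k by rewrite card_subg_of.
have cL : #|L|%:R = #|{: subg_of L}|%:R :> k by rewrite card_subg_of.
pose B := hecke w K L beta psi.
split.
- apply: central_scalar_indecomposable.
  + exact: (gspan_graded spK).
  + exact: (hecke_is_algebra hc (A := A) spK (twisted_mulE (N := K) beta)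
      (twisted_oneE K beta)
      (B := B) gspan_hbasis actl_hbasis actr_hbasis hmulE honeE).
  + exact: (hecke_central_scalar hc (B := B) gspan_hbasis hmulE).
- exact: (hecke_special hc (A := A) spK (twisted_mulE (N := K) beta)
      (twisted_oneE K beta)
    (B := B) gspan_hbasis actl_hbasis actr_hbasis hmulE honeE hcomulE hcounitE
    erefl (card0 K) (card0 L) cK cL).
- exact: (hecke_separable hc (A := A) spK (twisted_mulE (N := K) beta)
      (twisted_oneE K beta)
    (B := B) gspan_hbasis actl_hbasis actr_hbasis hmulE honeE hcomulE
    erefl (card0 K) (card0 L) cK cL).
Qed.

End HeckeInstance.

Theorem proposition6p7 (k : closedFieldType) (kchar0 : [pchar k] =i pred0)
    (gT : finGroupType) (w : gT -> gT -> gT -> k)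
    (wcocycle : cocycle3 w) (wnorm : normalized3 w)
    (K L : {group gT}) (beta psi : gT -> gT -> k)
    (betaK : cochain2 K beta) (betanorm : normalized2 K beta)
    (dbeta : trivializes K beta w)
    (psiL : cochain2 L psi) (psinorm : normalized2 L psi)
    (dpsi : trivializes L psi w) :
  [/\ indecomposable (hecke w K L beta psi),
      special (hecke w K L beta psi)
    & separable (hecke w K L beta psi)].
Proof.
exact: hecke_properties wcocycle wnorm betaK betanorm dbeta
  psiL psinorm dpsi kchar0.
Qed.
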